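(* Let $\varphi_C(z):=1+\dfrac{4z}{3}+\dfrac{2z^2}{3}$ for $z\in\mathbb{D}$, let $\varphi_{Ne}(z):=1+z-z^3/3$, and let $\beta\in\mathbb{R}$. Then, for $p\in\mathcal{H}$ with $p(0)=1$, each of the following subordinations is sufficient to imply that $p\prec\varphi_{Ne}$: (a) $1+\beta zp'(z)\prec\varphi_C(z)$, for $\beta\geq\dfrac52$; (b) $1+\beta\,\dfrac{zp'(z)}{p(z)}\prec\varphi_C(z)$, for $\beta\geq\dfrac{5}{3\log(5/3)}\approx3.26269$; (c) $1+\beta\,\dfrac{zp'(z)}{p^2(z)}\prec\varphi_C(z)$, for $\beta\geq\dfrac{25}{6}$. Moreover, each estimate on $\beta$ is sharp.
   Context: $\mathbb{D}=\{z\in\mathbb{C}:|z|<1\}$ and $\mathcal{H}$ is the set of all analytic functions on $\mathbb{D}$. For $f,g\in\mathcal{H}$, $f\prec g$ ($f$ is subordinate to $g$) means that there is $w\in\mathcal{H}$ with $w(0)=0$ and $|w(z)|<1$ for $z\in\mathbb{D}$ such that $f(z)=g(w(z))$ on $\mathbb{D}$; in particular, writing a subordination presupposes that both sides are analytic in $\mathbb{D}$. $\log$ of a positive number is the natural logarithm. That an estimate $\beta\ge\beta_0$ is sharp means that $\beta_0$ cannot be replaced by any smaller real number so that the implication remains valid for all such $p$ and all $\beta$ at least that number. *)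

(* Defs.v *)
From Stdlib Require Import Reals.
From Coquelicot Require Import Coquelicot.

Open Scope R_scope.
Open Scope C_scope.

Definition in_disk (z : C) : Prop := (Cmod z < 1)%R.

(* Functions on the disk are total functions C -> C; since the disk is open,
   [analytic f] (complex differentiability at every point of the disk) depends
   only on the values of f in the disk. *)
Definition analytic (f : C -> C) : Prop :=
  forall z : C, in_disk z -> @ex_derive C_AbsRing C_NormedModule f z.

(* Analyticity of both sides is part of the relation. In particular it gives
   a meaning to quotients: Coquelicot sets x / 0 = 0, but if p is analytic with
   p(0) = 1, then 1 + b z p'(z) / p(z)^k (k >= 1, b <> 0) tends to infinity at
   each zero of p, so it is analytic in the disk only if p has no zero there. *)
Definition subordinate (f g : C -> C) : Prop :=
  analytic f /\ analytic g /\
  exists w : C -> C,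
    analytic w /\ w 0 = 0 /\
    (forall z : C, in_disk z -> in_disk (w z)) /\
    (forall z : C, in_disk z -> f z = g (w z)).

Definition phi_C (z : C) : C := 1 + 4 * z / 3 + 2 * z ^ 2 / 3.

Definition phi_Ne (z : C) : C := 1 + z - z ^ 3 / 3.

Definition sufficient_for_Ne (Psi : (C -> C) -> C -> C) : Prop :=
  forall p : C -> C,
    analytic p -> p 0 = 1 ->
    subordinate (Psi p) phi_C -> subordinate p phi_Ne.

Definition valid_from (P : R -> Prop) (b : R) : Prop :=
  forall beta : R, (b <= beta)%R -> P beta.

Definition sharp (P : R -> Prop) (b0 : R) : Prop :=
  forall b : R, (b < b0)%R -> ~ valid_from P b.

Definition implication_a (beta : R) : Prop :=
  sufficient_for_Ne (fun p z => 1 + beta * z * C_derive p z).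

Definition implication_b (beta : R) : Prop :=
  sufficient_for_Ne (fun p z => 1 + beta * (z * C_derive p z / p z)).

Definition implication_c (beta : R) : Prop :=
  sufficient_for_Ne (fun p z => 1 + beta * (z * C_derive p z / p z ^ 2)).

(* Main.v *)
Require Import Defs.
From Stdlib Require Import Reals Lra Lia Psatz ClassicalEpsilon.
From Coquelicot Require Import Coquelicot.

(* The function omega - omega^3/3 maps the unit disk onto a region containing
   the disk of radius 2/3, so [|p - 1| < 2/3] suffices for [p] to be subordinate
   to [phi_Ne].  If [w] is the Schwarz function of the hypothesis, then
   [|w z| <= |z|], so in all three cases the subordination bounds [|p'|] on the
   ray through [z] by [(4/3 + 2t/3) / beta] times the appropriate power of [|p|],
   and integrating this differential inequality gives [|p - 1| < 2/3] for the
   stated [beta].  For smaller [beta] the extremal solution ([w z = z]) takes a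
   real value above 5/3 = phi_Ne(1), and [phi_Ne] takes no such value.

   Schwarz's lemma is needed for functions with mere pointwise complex
   derivatives: Goursat's bisection, applied to [f (exp (s + i t))] on rectangles
   in (s, t), makes circular means constant, which gives a Cauchy estimate. *)

Local Open Scope R_scope.

(** * Complex derivatives *)

(** Every threshold comes from the integral of 4/3 + 2t/3 over [0, 1], which is 5/3. The number 5/(3
    beta) bounds the increment of p in case (a), the growth of log |p| in (b) and the increment of
    1/p in (c), so keeping |p - 1| below 2/3 asks that 5/(3 beta) be at most 2/3, ln (5/3) or 1 -
    3/5 = 2/5 respectively. Passing to the inscribed disk costs nothing: |1 - omega^2/3| on the unit
    circle is least at omega = 1 and -1, where it is 2/3, and the extremal p leaves the disk |p - 1|
    < 2/3 through phi_Ne(1) = 5/3, one of the two contact points. Cases (b) and (c) have to exclude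
    zeros of p, where the totalised quotient says nothing about p'. The singularity of the quotient
    is not analysed: nonvanishing is propagated along each ray together with the estimate, since |p
    - 1| < 2/3 keeps |p| above 1/3. *)

Local Notation is_Cderive := (@is_derive C_AbsRing C_NormedModule).
Local Notation ex_Cderive := (@ex_derive C_AbsRing C_NormedModule).

(** Unfolds the filter definition once, so that later estimates can be made with [Cmod] alone;
    linearity of the differential is automatic over C. *)
Lemma is_Cderive_eps (f : C -> C) (z l : C) :
  is_Cderive f z l <->
  forall eps : R, 0 < eps -> exists d : R, 0 < d /\ forall y : C,
    Cmod (y - z) < d -> Cmod (f y - f z - (y - z) * l) <= eps * Cmod (y - z).
Proof.
split.
- intros [_ H] eps He.
  destruct (H z (fun P Q => Q) (mkposreal eps He)) as [d Hd].
  exists d; split; [apply cond_pos | exact Hd].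
- intros H; split.
  + apply is_linear_scal_l.
  + intros x Hx.
    apply (is_filter_lim_locally_unique (K := C_AbsRing)
    (V := AbsRing_NormedModule C_AbsRing)) in Hx; subst x.
    intros eps; destruct (H eps (cond_pos eps)) as [d [Hd K]].
    exists (mkposreal d Hd); exact K.
Qed.

Definition Ccontinuous (f : C -> C) (z : C) : Prop :=
  forall eps : R, 0 < eps -> exists d : R, 0 < d /\ forall y : C,
    Cmod (y - z) < d -> Cmod (f y - f z) < eps.

Lemma is_Cderive_continuous (f : C -> C) (z l : C) :
  is_Cderive f z l -> Ccontinuous f z.
Proof.
intros H eps He.
destruct (proj1 (is_Cderive_eps f z l) H 1 Rlt_0_1) as [d [Hd K]].
pose proof (Cmod_ge_0 l) as Hl.
(* With error 1 in the derivative the increment is at most (1 + |l|) |y - z|; the 2 leaves room for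
   strictness. *)
exists (Rmin d (eps / (2 + Cmod l))); split.
  apply Rmin_glb_lt; [lra | apply Rdiv_lt_0_compat; lra].
intros y Hy.
assert (H1 := K y (Rlt_le_trans _ _ _ Hy (Rmin_l _ _))).
assert (H2 : Cmod (y - z) < eps / (2 + Cmod l))
  by exact (Rlt_le_trans _ _ _ Hy (Rmin_r _ _)).
replace (f y - f z)%C with ((f y - f z - (y - z) * l) + (y - z) * l)%C by ring.
apply Rle_lt_trans with (1 := Cmod_triangle _ _).
rewrite Cmod_mult.
assert (H3 : eps / (2 + Cmod l) * (2 + Cmod l) = eps) by (field; lra).
pose proof (Cmod_ge_0 (y - z)); nra.
Qed.

Lemma is_Cderive_ext_loc (f g : C -> C) (z l : C) (d : R) : 0 < d ->
  (forall y, Cmod (y - z) < d -> f y = g y) ->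
  is_Cderive f z l -> is_Cderive g z l.
Proof.
intros Hd E; apply is_derive_ext_loc.
exists (mkposreal d Hd); exact E.
Qed.

Lemma is_Cderive_const (c z : C) : is_Cderive (fun _ => c) z (0 : C)%C.
Proof. exact (@is_derive_const C_AbsRing C_NormedModule c z). Qed.

(* The two normed module structures of C over itself in Coquelicot do not
   unify; general lemmas on products use the first one. *)
Lemma is_derive_AbsRing (f : C -> C) (z l : C) :
  @is_derive C_AbsRing (AbsRing_NormedModule C_AbsRing) f z l <-> is_Cderive f z l.
Proof. split; intros [_ H]; (split; [apply is_linear_scal_l | exact H]). Qed.

Lemma is_Cderive_id (z : C) : is_Cderive (fun y => y) z (1 : C)%C.
Proof. apply is_derive_AbsRing; exact (@is_derive_id C_AbsRing z). Qed.

Lemma is_Cderive_plus (f g : C -> C) (z a b : C) : is_Cderive f z a ->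
  is_Cderive g z b -> is_Cderive (fun y => f y + g y)%C z (a + b)%C.
Proof. exact (@is_derive_plus C_AbsRing C_NormedModule f g z a b). Qed.

Lemma is_Cderive_minus (f g : C -> C) (z a b : C) : is_Cderive f z a ->
  is_Cderive g z b -> is_Cderive (fun y => f y - g y)%C z (a - b)%C.
Proof. exact (@is_derive_minus C_AbsRing C_NormedModule f g z a b). Qed.

Lemma is_Cderive_mult (f g : C -> C) (z a b : C) : is_Cderive f z a ->
  is_Cderive g z b -> is_Cderive (fun y => f y * g y)%C z (a * g z + f z * b)%C.
Proof.
intros Hf Hg; apply is_derive_AbsRing in Hf; apply is_derive_AbsRing in Hg.
apply is_derive_AbsRing.
exact (@is_derive_mult C_AbsRing f g z a b Hf Hg Cmult_comm).
Qed.

Lemma is_Cderive_comp (f g : C -> C) (z a b : C) : is_Cderive f (g z) a ->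
  is_Cderive g z b -> is_Cderive (fun y => f (g y)) z (b * a)%C.
Proof.
intros Hf Hg; apply is_derive_AbsRing in Hg.
exact (@is_derive_comp C_AbsRing C_NormedModule f g z a b Hf Hg).
Qed.

Lemma is_Cderive_inv (z : C) : z <> 0%C -> is_Cderive Cinv z (- / (z * z))%C.
Proof.
intros Hz; apply is_Cderive_eps; intros eps He.
assert (Pz : 0 < Cmod z) by (apply Cmod_gt_0; exact Hz).
set (m := Cmod z) in *.
(* The error is |y - z|^2 / |z^2 y|. The first radius gives |y| > m/2, so the denominator exceeds
   m^3/2, and the second radius compensates for it. *)
exists (Rmin (m / 2) (eps * m ^ 3 / 2)); split.
  apply Rmin_glb_lt; [lra|].
  assert (0 < m ^ 3) by (apply pow_lt; exact Pz); nra.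
intros y Hy.
assert (H1 : Cmod (y - z) < m / 2)
  by exact (Rlt_le_trans _ _ _ Hy (Rmin_l _ _)).
assert (H2 : Cmod (y - z) < eps * m ^ 3 / 2)
  by exact (Rlt_le_trans _ _ _ Hy (Rmin_r _ _)).
assert (H3 : m / 2 < Cmod y).
  assert (T := Cmod_triangle y (- (y - z))).
  replace (y + - (y - z))%C with z in T by ring.
  rewrite Cmod_opp in T; fold m in T; lra.
assert (Hy0 : y <> 0%C) by (apply Cmod_gt_0; lra).
replace (/ y - / z - (y - z) * - / (z * z))%C
  with ((y - z) * ((y - z) * / (z * z * y)))%C by (field; auto).
rewrite !Cmod_mult, Cmod_inv, !Cmod_mult.
2: { intros E; apply Hz.
     assert (z * z * y * / y * / z = 0)%C by (rewrite E; ring).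
     rewrite <- H; field; auto. }
fold m; rewrite Rmult_comm; apply Rmult_le_compat_r; [apply Cmod_ge_0|].
assert (Py : 0 < m * m * Cmod y) by (repeat apply Rmult_lt_0_compat; lra).
apply Rmult_le_reg_r with (m * m * Cmod y); [exact Py|].
rewrite Rmult_assoc, Rinv_l by lra.
assert (0 < m * m) by nra.
assert (eps * (m * m * (m / 2)) <= eps * (m * m * Cmod y)).
  apply Rmult_le_compat_l; [lra|]; apply Rmult_le_compat_l; lra.
simpl in H2; lra.
Qed.

Lemma is_Cderive_div (f g : C -> C) (z a b : C) : g z <> 0%C ->
  is_Cderive f z a -> is_Cderive g z b ->
  is_Cderive (fun y => f y / g y)%C z ((a * g z - f z * b) / (g z * g z))%C.
Proof.
intros Hz Hf Hg.
replace ((a * g z - f z * b) / (g z * g z))%C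
  with (a * / g z + f z * (b * - / (g z * g z)))%C by (field; auto).
apply (is_Cderive_mult f (fun y => / g y)%C); [exact Hf|].
apply (is_Cderive_comp Cinv g); [apply is_Cderive_inv; exact Hz | exact Hg].
Qed.

Lemma is_Cderive_pow (f : C -> C) (z a : C) (n : nat) : is_Cderive f z a ->
  ex_Cderive (fun y => f y ^ n)%C z.
Proof.
intros Hf; induction n as [|n [l IH]].
- exists (RtoC 0); exact (is_Cderive_const (RtoC 1) z).
- eexists; simpl; apply (is_Cderive_mult f (fun y => f y ^ n)%C); eassumption.
Qed.

(** The Cauchy-Riemann equations: the four partial derivatives are the real matrix of multiplication
    by [l]. Real differentiability uses the max norm, and its comparison with [Cmod] costs sqrt
    2. *)
Lemma is_Cderive_differentiable (f : C -> C) (x y : R) (l : C) :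
  is_Cderive f (x, y) l ->
  differentiable_pt_lim (fun u v => Re (f (u, v))) x y (Re l) (- Im l) /\
  differentiable_pt_lim (fun u v => Im (f (u, v))) x y (Im l) (Re l).
Proof.
intros H.
assert (S2 : 0 < sqrt 2) by (apply sqrt_lt_R0; lra).
assert (K : forall eps : posreal, locally_2d (fun u v =>
  Cmod (f (u, v) - f (x, y) - ((u, v) - (x, y)) * l) <=
    eps * Rmax (Rabs (u - x)) (Rabs (v - y))) x y).
{ intros eps.
  destruct (proj1 (is_Cderive_eps _ _ _) H (eps / sqrt 2)) as [d [Hd K]].
    apply Rdiv_lt_0_compat; [apply cond_pos | exact S2].
  assert (Hd' : 0 < d / sqrt 2) by (apply Rdiv_lt_0_compat; assumption).
  exists (mkposreal _ Hd'); simpl; intros u v Hu Hv.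
  assert (B : Cmod ((u, v) - (x, y)) <= sqrt 2 * Rmax (Rabs (u - x)) (Rabs (v - y)))
    by exact (Cmod_2Rmax ((u, v) - (x, y))%C).
  assert (M : Rmax (Rabs (u - x)) (Rabs (v - y)) < d / sqrt 2)
    by (apply Rmax_lub_lt; assumption).
  assert (E : sqrt 2 * (d / sqrt 2) = d) by (field; lra).
  eapply Rle_trans; [apply K; nra|].
  apply Rle_trans with (eps / sqrt 2 * (sqrt 2 * Rmax (Rabs (u - x)) (Rabs (v - y)))).
    apply Rmult_le_compat_l; [|exact B].
    apply Rlt_le, Rdiv_lt_0_compat; [apply cond_pos | exact S2].
  apply Req_le; field; lra. }
split; intros eps; destruct (K eps) as [d Hd]; exists d; intros u v Hu Hv;
  (eapply Rle_trans; [|apply (Hd u v Hu Hv)]);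
  (eapply Rle_trans; [|apply Rmax_Cmod]).
- eapply Rle_trans; [|apply Rmax_l].
  apply Req_le; f_equal; destruct (f (u, v)), (f (x, y)), l; simpl; ring.
- eapply Rle_trans; [|apply Rmax_r].
  apply Req_le; f_equal; destruct (f (u, v)), (f (x, y)), l; simpl; ring.
Qed.

(** Converse of Cauchy-Riemann, for [Cexp], which is given by its real and imaginary parts. *)
Lemma differentiable_is_Cderive (f : C -> C) (x y : R) (l : C) :
  differentiable_pt_lim (fun u v => Re (f (u, v))) x y (Re l) (- Im l) ->
  differentiable_pt_lim (fun u v => Im (f (u, v))) x y (Im l) (Re l) ->
  is_Cderive f (x, y) l.
Proof.
intros H1 H2; apply is_Cderive_eps; intros eps He.
assert (S2 : 0 < sqrt 2) by (apply sqrt_lt_R0; lra).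
assert (He' : 0 < eps / sqrt 2) by (apply Rdiv_lt_0_compat; assumption).
destruct (H1 (mkposreal _ He')) as [d1 K1].
destruct (H2 (mkposreal _ He')) as [d2 K2].
exists (Rmin d1 d2); split; [apply Rmin_glb_lt; apply cond_pos|].
intros [u v] Hu.
assert (B := Rmax_Cmod ((u, v) - (x, y))%C).
change (Rmax (Rabs (u - x)) (Rabs (v - y)) <= Cmod ((u, v) - (x, y))%C) in B.
assert (Bu := Rle_trans _ _ _ (Rmax_l _ _) B).
assert (Bv := Rle_trans _ _ _ (Rmax_r _ _) B).
assert (D1 := Rmin_l d1 d2); assert (D2 := Rmin_r d1 d2).
assert (E1 := K1 u v ltac:(lra) ltac:(lra)).
assert (E2 := K2 u v ltac:(lra) ltac:(lra)).
simpl in E1, E2.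
eapply Rle_trans; [apply Cmod_2Rmax|].
apply Rle_trans with (sqrt 2 * (eps / sqrt 2 * Cmod ((u, v) - (x, y)))).
2: apply Req_le; field; lra.
apply Rmult_le_compat_l; [lra|].
apply Rle_trans with (eps / sqrt 2 * Rmax (Rabs (u - x)) (Rabs (v - y))).
2: apply Rmult_le_compat_l; [lra | exact B].
apply Rmax_lub; [eapply Rle_trans; [|exact E1] | eapply Rle_trans; [|exact E2]];
  apply Req_le; f_equal; destruct (f (u, v)), (f (x, y)), l; simpl; ring.
Qed.

(** The chain rule along a ray, split into real and imaginary parts so that the real mean value
    theorem applies. *)
Lemma is_derive_ray (f : C -> C) (zeta l : C) (t : R) :
  is_Cderive f (t * zeta)%C l ->
  is_derive (fun s : R => Re (f (s * zeta)%C)) t (Re (l * zeta)%C) /\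
  is_derive (fun s : R => Im (f (s * zeta)%C)) t (Im (l * zeta)%C).
Proof.
intros H.
assert (E : forall t : R, (t * zeta)%C = (t * Re zeta, t * Im zeta)).
{ intros s; apply injective_projections; destruct zeta; simpl; ring. }
rewrite E in H.
apply is_Cderive_differentiable in H; destruct H as [H1 H2].
assert (D : forall c : R, derivable_pt_lim (fun t => t * c) t c).
{ intros c; apply is_derive_Reals; auto_derive; [trivial | ring]. }
split.
- apply is_derive_ext with (fun t : R => Re (f (t * Re zeta, t * Im zeta))).
    intros s; rewrite E; reflexivity.
  apply is_derive_Reals.
  replace (Re (l * zeta)%C) with (Re l * Re zeta + - Im l * Im zeta)
    by (destruct l, zeta; simpl; ring).
  exact (derivable_pt_lim_comp_2d _ _ _ t _ _ _ _ H1 (D _) (D _)).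
- apply is_derive_ext with (fun t : R => Im (f (t * Re zeta, t * Im zeta))).
    intros s; rewrite E; reflexivity.
  apply is_derive_Reals.
  replace (Im (l * zeta)%C) with (Im l * Re zeta + Re l * Im zeta)
    by (destruct l, zeta; simpl; ring).
  exact (derivable_pt_lim_comp_2d _ _ _ t _ _ _ _ H2 (D _) (D _)).
Qed.

(** Log-polar coordinates: the vertical segment of length 2 PI over [s] becomes the circle of radius
    exp s. The extremal function of case (b) is built from it too. *)
Definition Cexp (z : C) : C := (exp (Re z) * cos (Im z), exp (Re z) * sin (Im z)).

Lemma differentiable_pt_lim_mult_fst_snd (f g : R -> R) (x y a b : R) :
  derivable_pt_lim f x a -> derivable_pt_lim g y b ->
  differentiable_pt_lim (fun u v => f u * g v) x y (a * g y) (f x * b).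
Proof.
intros Hf Hg.
apply filterdiff_differentiable_pt_lim.
apply is_derive_Reals in Hf; apply is_derive_Reals in Hg.
assert (F : filterdiff (fun u : R * R => f (fst u)) (locally (x, y))
   (fun u => scal (fst u) a)).
{ apply (filterdiff_comp' fst f (x, y) fst (fun u : R => scal u a)).
  apply filterdiff_linear, is_linear_fst.
  exact Hf. }
assert (G : filterdiff (fun u : R * R => g (snd u)) (locally (x, y))
   (fun u => scal (snd u) b)).
{ apply (filterdiff_comp' snd g (x, y) snd (fun u : R => scal u b)).
  apply filterdiff_linear, is_linear_snd.
  exact Hg. }
assert (M := filterdiff_mult_fct (fun u : R * R => f (fst u))
  (fun u : R * R => g (snd u)) (x, y) _ _ Rmult_comm F G).
eapply filterdiff_ext_lin; [exact M|].
intros [u v]; unfold plus, mult, scal; simpl; unfold mult; simpl; ring.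
Qed.

Lemma is_Cderive_exp (z : C) : is_Cderive Cexp z (Cexp z).
Proof.
destruct z as [x y]; apply differentiable_is_Cderive; simpl.
- replace (- (exp x * sin y)) with (exp x * - sin y) by ring.
  apply (differentiable_pt_lim_mult_fst_snd exp cos);
    [apply derivable_pt_lim_exp | apply derivable_pt_lim_cos].
- apply (differentiable_pt_lim_mult_fst_snd exp sin);
    [apply derivable_pt_lim_exp | apply derivable_pt_lim_sin].
Qed.

Lemma Cmod_Cexp (z : C) : Cmod (Cexp z) = exp (Re z).
Proof.
unfold Cmod, Cexp; simpl.
replace (_ + _) with (exp (Re z) * exp (Re z)).
  apply sqrt_square, Rlt_le, exp_pos.
pose proof (sin2_cos2 (Im z)) as H; unfold Rsqr in H.
transitivity (exp (Re z) * exp (Re z) * (sin (Im z) * sin (Im z) + cos (Im z) * cos (Im z))).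
  rewrite H; ring.
ring.
Qed.

Lemma Cexp_neq_0 (z : C) : Cexp z <> 0%C.
Proof. apply Cmod_gt_0; rewrite Cmod_Cexp; apply exp_pos. Qed.

(** * Goursat's theorem for real forms *)

(** The supremum of the left ends works, because every left end lies below every right end. *)
Lemma nested_intervals (x : nat -> R) (w : R) : 0 <= w ->
  (forall n, x n <= x (S n) /\ x (S n) + w / 2 ^ S n <= x n + w / 2 ^ n) ->
  exists l, forall n, x n <= l <= x n + w / 2 ^ n.
Proof.
intros Hw H.
assert (P2 : forall n, 0 <= w / 2 ^ n).
{ intros n; apply Rmult_le_pos; [exact Hw|].
  apply Rlt_le, Rinv_0_lt_compat, pow_lt; lra. }
assert (I : forall n k, x n <= x (n + k)%nat /\
  x (n + k)%nat + w / 2 ^ (n + k) <= x n + w / 2 ^ n).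
{ intros n k; induction k as [|k IH].
  - rewrite Nat.add_0_r; lra.
  - rewrite Nat.add_succ_r; destruct (H (n + k)%nat); lra. }
assert (B : forall n m, x m <= x n + w / 2 ^ n).
{ intros n m; destruct (Nat.le_ge_cases n m) as [L|L].
  - destruct (I n (m - n)%nat) as [_ K].
    replace (n + (m - n))%nat with m in K by lia.
    pose proof (P2 m); lra.
  - destruct (I m (n - m)%nat) as [K _].
    replace (m + (n - m))%nat with n in K by lia.
    pose proof (P2 n); lra. }
destruct (completeness (fun r => exists n, r = x n)) as [l [L1 L2]].
- exists (x 0%nat + w / 2 ^ 0); intros r [n ->]; apply B.
- exists (x 0%nat); exists 0%nat; reflexivity.
- exists l; intros n; split.
  + apply L1; exists n; reflexivity.
  + apply L2; intros r [m ->]; apply B.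
Qed.

(** Otherwise every bad rectangle has a bad quarter, and a nested sequence of bad quarters shrinks
    to a point where [local_G] is violated. *)
Lemma rectangle_bisection (G : R -> R -> R -> R -> Prop) (a b c d : R) :
  a <= b -> c <= d ->
  (forall a' b' c' d', a <= a' -> a' <= b' -> b' <= b -> c <= c' -> c' <= d' -> d' <= d ->
     let m := (a' + b') / 2 in let n := (c' + d') / 2 in
     G a' m c' n -> G m b' c' n -> G a' m n d' -> G m b' n d' -> G a' b' c' d') ->
  (forall x y, a <= x <= b -> c <= y <= d -> exists delta, 0 < delta /\
     forall a' b' c' d', a <= a' -> a' <= x <= b' -> b' <= b ->
       c <= c' -> c' <= y <= d' -> d' <= d ->
       b' - a' < delta -> d' - c' < delta -> G a' b' c' d') ->
  G a b c d.
Proof.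
intros Hab Hcd split_G local_G.
apply NNPP; intros bad_G.
set (w := b - a); set (h := d - c).
assert (Hw : 0 <= w) by (unfold w; lra).
assert (Hh : 0 <= h) by (unfold h; lra).
(* A rectangle of level [n] is stored by its lower left corner; its sides are [w / 2 ^ n] and
   [h / 2 ^ n]. *)
set (Bad := fun (n : nat) (p : R * R) =>
  a <= fst p /\ fst p + w / 2 ^ n <= b /\ c <= snd p /\ snd p + h / 2 ^ n <= d /\
  ~ G (fst p) (fst p + w / 2 ^ n) (snd p) (snd p + h / 2 ^ n)).
set (Next := fun (n : nat) (p q : R * R) => Bad (S n) q /\
  (fst p <= fst q /\ fst q + w / 2 ^ S n <= fst p + w / 2 ^ n) /\
  (snd p <= snd q /\ snd q + h / 2 ^ S n <= snd p + h / 2 ^ n)).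
assert (Half : forall r n, r / 2 ^ n = r / 2 ^ S n + r / 2 ^ S n).
{ intros r n; simpl; field; apply pow_nonzero; lra. }
assert (Pos : forall r n, 0 <= r -> 0 <= r / 2 ^ n).
{ intros r n Hr; apply Rmult_le_pos; [exact Hr|].
  apply Rlt_le, Rinv_0_lt_compat, pow_lt; lra. }
assert (step : forall n p, Bad n p -> exists q, Next n p q).
{ intros n [x y] (B1 & B2 & B3 & B4 & B5); cbn [fst snd] in B1, B2, B3, B4, B5.
  apply NNPP; intros N; apply B5; clear B5.
  rewrite (Half w n) in B2 |- *; rewrite (Half h n) in B4 |- *.
  pose proof (Pos w (S n) Hw); pose proof (Pos h (S n) Hh).
  set (w' := w / 2 ^ S n) in *; set (h' := h / 2 ^ S n) in *.
  (* Without a bad successor all four quarters satisfy [G], and [split_G] glues them. *)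
  assert (Q : forall x' y', (x' = x \/ x' = x + w') -> (y' = y \/ y' = y + h') ->
    G x' (x' + w') y' (y' + h')).
  { intros x' y' Hx Hy; apply NNPP; intros NG; apply N.
    exists (x', y'); unfold Next, Bad; cbn [fst snd]; fold w' h'.
    rewrite (Half w n), (Half h n); fold w' h'.
    destruct Hx as [-> | ->], Hy as [-> | ->]; repeat split; first [lra | exact NG]. }
  apply split_G; try lra.
  - replace ((x + (x + (w' + w'))) / 2) with (x + w') by field.
    replace ((y + (y + (h' + h'))) / 2) with (y + h') by field.
    apply Q; left; reflexivity.
  - replace ((x + (x + (w' + w'))) / 2) with (x + w') by field.
    replace ((y + (y + (h' + h'))) / 2) with (y + h') by field.
    replace (x + (w' + w')) with (x + w' + w') by ring.
    apply Q; [right | left]; reflexivity.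
  - replace ((x + (x + (w' + w'))) / 2) with (x + w') by field.
    replace ((y + (y + (h' + h'))) / 2) with (y + h') by field.
    replace (y + (h' + h')) with (y + h' + h') by ring.
    apply Q; [left | right]; reflexivity.
  - replace ((x + (x + (w' + w'))) / 2) with (x + w') by field.
    replace ((y + (y + (h' + h'))) / 2) with (y + h') by field.
    replace (x + (w' + w')) with (x + w' + w') by ring.
    replace (y + (h' + h')) with (y + h' + h') by ring.
    apply Q; right; reflexivity. }
(* Dependent choice of a bad quarter at each level, through [epsilon]. *)
assert (inh : inhabited (R * R)) by exact (inhabits (a, c)).
set (p := fix p n := match n with
  | O => (a, c) | S n => epsilon inh (Next n (p n)) end).
assert (Hbad : forall n, Bad n (p n)).
{ induction n as [|n IH].
  - unfold Bad; simpl p; simpl fst; simpl snd; simpl pow.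
    replace (a + w / 1) with b by (unfold w; field).
    replace (c + h / 1) with d by (unfold h; field).
    repeat split; first [lra | exact bad_G].
  - exact (proj1 (epsilon_spec inh (Next n (p n)) (step n (p n) IH))). }
assert (Hnext : forall n, Next n (p n) (p (S n)))
  by (intros n; exact (epsilon_spec inh (Next n (p n)) (step n (p n) (Hbad n)))).
destruct (nested_intervals (fun n => fst (p n)) w Hw
  (fun n => proj1 (proj2 (Hnext n)))) as [x Hx].
destruct (nested_intervals (fun n => snd (p n)) h Hh
  (fun n => proj2 (proj2 (Hnext n)))) as [y Hy].
assert (Rx : a <= x <= b).
{ specialize (Hx 0%nat); simpl in Hx.
  replace (a + w / 1) with b in Hx by (unfold w; field); exact Hx. }
assert (Ry : c <= y <= d).
{ specialize (Hy 0%nat); simpl in Hy.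
  replace (c + h / 1) with d in Hy by (unfold h; field); exact Hy. }
destruct (local_G x y Rx Ry) as [delta [Hd HG]].
(* Dividing by 1 + w + h rather than w + h covers the degenerate rectangle. *)
assert (Small : exists n, (w + h) / 2 ^ n < delta).
{ destruct (pow_lt_1_zero (/ 2)) with (y := delta / (1 + w + h)) as [n Hn].
  - rewrite Rabs_pos_eq; lra.
  - apply Rdiv_lt_0_compat; lra.
  - exists n; specialize (Hn n (Nat.le_refl n)).
    rewrite Rabs_pos_eq in Hn by (apply pow_le; lra).
    rewrite pow_inv in Hn.
    apply Rle_lt_trans with ((1 + w + h) * / 2 ^ n).
      apply Rmult_le_compat_r; [apply Rlt_le, Rinv_0_lt_compat, pow_lt; lra | lra].
    apply Rlt_le_trans with ((1 + w + h) * (delta / (1 + w + h))).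
      apply Rmult_lt_compat_l; [lra | exact Hn].
    apply Req_le; field; lra. }
destruct Small as [n Hn].
replace ((w + h) / 2 ^ n) with (w / 2 ^ n + h / 2 ^ n) in Hn
  by (field; apply pow_nonzero; lra).
pose proof (Pos w n Hw); pose proof (Pos h n Hh).
destruct (Hbad n) as (B1 & B2 & B3 & B4 & B5); apply B5.
apply HG; try lra; [apply Hx | apply Hy].
Qed.

(** The shared [k] is both the y-derivative of P and the x-derivative of Q: d(P dx + Q dy) = 0 at
    the point. *)
Definition closed_form_at (P Q : R -> R -> R) (x y : R) : Prop :=
  exists p q k, differentiable_pt_lim P x y p k /\ differentiable_pt_lim Q x y k q.

Lemma continuity_2d_pt_sections (F : R -> R -> R) (x y : R) :
  continuity_2d_pt F x y ->
  continuous (fun u => F u y) x /\ continuous (fun v => F x v) y.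
Proof.
intros H; apply continuity_2d_pt_filterlim in H; split.
- apply (filterlim_comp _ _ _ (fun u : R => (u, y)) (fun z => F (fst z) (snd z))
    (locally x) (locally (x, y))); [|exact H].
  intros S [e He]; exists e; intros u Hu; apply He; split; [exact Hu | apply ball_center].
- apply (filterlim_comp _ _ _ (fun v : R => (x, v)) (fun z => F (fst z) (snd z))
    (locally y) (locally (x, y))); [|exact H].
  intros S [e He]; exists e; intros u Hu; apply He; split; [apply ball_center | exact Hu].
Qed.

Lemma ex_RInt_sections (F : R -> R -> R) (a b c d : R) :
  (forall x y, a <= x <= b -> c <= y <= d -> continuity_2d_pt F x y) ->
  (forall y a' b', c <= y <= d -> a <= a' -> a' <= b' -> b' <= b ->
     ex_RInt (fun x => F x y) a' b') /\
  (forall x c' d', a <= x <= b -> c <= c' -> c' <= d' -> d' <= d ->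
     ex_RInt (fun y => F x y) c' d').
Proof.
intros HF; split.
- intros y a' b' Hy A1 A2 A3; apply (ex_RInt_continuous (V := R_CompleteNormedModule)); intros x Hx.
  rewrite Rmin_left, Rmax_right in Hx by lra.
  apply (continuity_2d_pt_sections F x y), HF; lra.
- intros x c' d' Hx A1 A2 A3; apply (ex_RInt_continuous (V := R_CompleteNormedModule)); intros y Hy.
  rewrite Rmin_left, Rmax_right in Hy by lra.
  apply (continuity_2d_pt_sections F x y), HF; lra.
Qed.

Lemma RInt_Rminus (f g : R -> R) (a b : R) : ex_RInt f a b -> ex_RInt g a b ->
  RInt (fun x => f x - g x) a b = RInt f a b - RInt g a b.
Proof. exact (RInt_minus (V := R_CompleteNormedModule) f g a b). Qed.

Lemma RInt_Rconst (r a b : R) : RInt (fun _ => r) a b = (b - a) * r.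
Proof. exact (RInt_const (V := R_CompleteNormedModule) a b r). Qed.

(* Green's formula without continuity of the partial derivatives: Goursat's
   bisection argument, for real forms [P dx + Q dy]. *)
Lemma goursat (P Q : R -> R -> R) (a b c d : R) : a <= b -> c <= d ->
  (forall x y, a <= x <= b -> c <= y <= d -> closed_form_at P Q x y) ->
  RInt (fun x => P x d) a b - RInt (fun x => P x c) a b =
  RInt (fun y => Q b y) c d - RInt (fun y => Q a y) c d.
Proof.
intros Hab Hcd HPQ.
destruct (ex_RInt_sections P a b c d) as [IP _].
{ intros x y Hx Hy; destruct (HPQ x y Hx Hy) as (p & q & k & DP & _).
  apply differentiable_continuity_pt; exists p, k; exact DP. }
destruct (ex_RInt_sections Q a b c d) as [_ IQ].
{ intros x y Hx Hy; destruct (HPQ x y Hx Hy) as (p & q & k & _ & DQ).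
  apply differentiable_continuity_pt; exists k, q; exact DQ. }
set (J := fun a b c d => RInt (fun x => P x d) a b - RInt (fun x => P x c) a b -
  (RInt (fun y => Q b y) c d - RInt (fun y => Q a y) c d)).
(* This bound is additive under bisection: each quarter has a quarter of the sum of squared
   sides. *)
enough (K : forall eps, 0 < eps -> Rabs (J a b c d) <= eps * ((b - a) ^ 2 + (d - c) ^ 2)).
{ assert (J0 : J a b c d = 0); [|unfold J in J0; lra].
  apply Rabs_eq_0, Rle_antisym; [|apply Rabs_pos].
  apply le_epsilon; intros eps He.
  set (s := (b - a) ^ 2 + (d - c) ^ 2) in *.
  assert (Hs : 0 <= s)
    by (unfold s; pose proof (pow2_ge_0 (b - a)); pose proof (pow2_ge_0 (d - c)); lra).
  eapply Rle_trans; [apply (K (eps / (1 + s)))|].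
  - apply Rdiv_lt_0_compat; lra.
  - assert (E : eps / (1 + s) * (1 + s) = eps) by (field; lra).
    assert (0 < eps / (1 + s)) by (apply Rdiv_lt_0_compat; lra). lra. }
intros eps He.
apply (rectangle_bisection (fun a b c d =>
  Rabs (J a b c d) <= eps * ((b - a) ^ 2 + (d - c) ^ 2)) a b c d Hab Hcd).
- intros a' b' c' d' A1 A2 A3 A4 A5 A6 m n G1 G2 G3 G4.
  assert (M : a' <= m <= b') by (unfold m; lra).
  assert (N : c' <= n <= d') by (unfold n; lra).
  assert (CP : forall y, c <= y <= d -> RInt (fun x => P x y) a' b' =
    RInt (fun x => P x y) a' m + RInt (fun x => P x y) m b').
  { intros y Hy; symmetry; apply (RInt_Chasles (V := R_CompleteNormedModule)
      (fun x => P x y)); apply IP; lra. }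
  assert (CQ : forall x, a <= x <= b -> RInt (fun y => Q x y) c' d' =
    RInt (fun y => Q x y) c' n + RInt (fun y => Q x y) n d').
  { intros x Hx; symmetry; apply (RInt_Chasles (V := R_CompleteNormedModule)
      (fun y => Q x y)); apply IQ; lra. }
  assert (E : J a' b' c' d' = J a' m c' n + J m b' c' n + (J a' m n d' + J m b' n d')).
  { unfold J; rewrite !(CP c'), !(CP d'), !(CQ a'), !(CQ b') by lra; ring. }
  rewrite E.
  eapply Rle_trans; [apply Rabs_triang|].
  eapply Rle_trans; [apply Rplus_le_compat; apply Rabs_triang|].
  replace (eps * ((b' - a') ^ 2 + (d' - c') ^ 2)) with
    (eps * ((m - a') ^ 2 + (n - c') ^ 2) + eps * ((b' - m) ^ 2 + (n - c') ^ 2) +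
     (eps * ((m - a') ^ 2 + (d' - n) ^ 2) + eps * ((b' - m) ^ 2 + (d' - n) ^ 2)))
    by (unfold m, n; field).
  lra.
- intros u v Hu Hv.
  destruct (HPQ u v Hu Hv) as (p & q & k & DP & DQ).
  (* Near (u, v) both P and Q are affine up to eps/4 (w + h). Over the four sides this adds up to
     eps/2 (w + h)^2, at most eps (w^2 + h^2). *)
  assert (He4 : 0 < eps / 4) by lra.
  destruct (DP (mkposreal _ He4)) as [d1 K1].
  destruct (DQ (mkposreal _ He4)) as [d2 K2].
  simpl in K1, K2.
  exists (Rmin d1 d2); split; [apply Rmin_glb_lt; apply cond_pos|].
  intros a' b' c' d' A1 A2 A3 A4 A5 A6 W H.
  pose proof (Rmin_l d1 d2); pose proof (Rmin_r d1 d2).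
  set (w := b' - a') in *; set (h := d' - c') in *.
  assert (EP : forall x y, a' <= x <= b' -> c' <= y <= d' ->
    Rabs (P x y - P u v - (p * (x - u) + k * (y - v))) <= eps / 4 * (w + h)).
  { intros x y Hx Hy.
    assert (B1 : Rabs (x - u) <= w) by (apply Rabs_le; unfold w; lra).
    assert (B2 : Rabs (y - v) <= h) by (apply Rabs_le; unfold h; lra).
    pose proof (Rabs_pos (x - u)); pose proof (Rabs_pos (y - v)).
    eapply Rle_trans; [apply K1; lra|].
    apply Rmult_le_compat_l; [lra | apply Rmax_lub; lra]. }
  assert (EQ : forall x y, a' <= x <= b' -> c' <= y <= d' ->
    Rabs (Q x y - Q u v - (k * (x - u) + q * (y - v))) <= eps / 4 * (w + h)).
  { intros x y Hx Hy.
    assert (B1 : Rabs (x - u) <= w) by (apply Rabs_le; unfold w; lra).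
    assert (B2 : Rabs (y - v) <= h) by (apply Rabs_le; unfold h; lra).
    pose proof (Rabs_pos (x - u)); pose proof (Rabs_pos (y - v)).
    eapply Rle_trans; [apply K2; lra|].
    apply Rmult_le_compat_l; [lra | apply Rmax_lub; lra]. }
  (* The affine parts contribute k w h here and again in [JQ], and the two cancel in [J]. *)
  assert (JP : Rabs (RInt (fun x => P x d') a' b' - RInt (fun x => P x c') a' b' - w * (k * h))
    <= w * (eps / 2 * (w + h))).
  { assert (XP : ex_RInt (fun x => P x d' - P x c') a' b')
      by (apply (ex_RInt_minus (V := R_NormedModule)); apply IP; lra).
    assert (XC : ex_RInt (fun _ => k * h) a' b') by apply (ex_RInt_const (V := R_NormedModule)).
    replace (RInt (fun x => P x d') a' b' - RInt (fun x => P x c') a' b' - w * (k * h))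
      with (RInt (fun x => P x d' - P x c' - k * h) a' b').
    + apply abs_RInt_le_const; [lra | apply (ex_RInt_minus (V := R_NormedModule)); assumption|].
      intros x Hx.
      assert (T1 := EP x d' Hx ltac:(lra)); assert (T2 := EP x c' Hx ltac:(lra)).
      apply Rabs_le_between in T1; apply Rabs_le_between in T2.
      unfold h in *; apply Rabs_le; lra.
    + rewrite (RInt_Rminus (fun x => P x d' - P x c') (fun _ => k * h)) by assumption.
      rewrite RInt_Rconst; unfold w; f_equal.
      apply (RInt_Rminus (fun x => P x d')); apply IP; lra. }
  assert (JQ : Rabs (RInt (fun y => Q b' y) c' d' - RInt (fun y => Q a' y) c' d' - h * (k * w))
    <= h * (eps / 2 * (w + h))).
  { assert (XP : ex_RInt (fun y => Q b' y - Q a' y) c' d')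
      by (apply (ex_RInt_minus (V := R_NormedModule)); apply IQ; lra).
    assert (XC : ex_RInt (fun _ => k * w) c' d') by apply (ex_RInt_const (V := R_NormedModule)).
    replace (RInt (fun y => Q b' y) c' d' - RInt (fun y => Q a' y) c' d' - h * (k * w))
      with (RInt (fun y => Q b' y - Q a' y - k * w) c' d').
    + apply abs_RInt_le_const; [lra | apply (ex_RInt_minus (V := R_NormedModule)); assumption|].
      intros y Hy.
      assert (T1 := EQ b' y ltac:(lra) Hy); assert (T2 := EQ a' y ltac:(lra) Hy).
      apply Rabs_le_between in T1; apply Rabs_le_between in T2.
      unfold w in *; apply Rabs_le; lra.
    + rewrite (RInt_Rminus (fun y => Q b' y - Q a' y) (fun _ => k * w)) by assumption.
      rewrite RInt_Rconst; unfold h; f_equal.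
      apply (RInt_Rminus (fun y => Q b' y)); apply IQ; lra. }
  replace (J a' b' c' d') with
    ((RInt (fun x => P x d') a' b' - RInt (fun x => P x c') a' b' - w * (k * h)) -
     (RInt (fun y => Q b' y) c' d' - RInt (fun y => Q a' y) c' d' - h * (k * w)))
    by (unfold J; ring).
  eapply Rle_trans; [apply Rabs_triang|]; rewrite Rabs_Ropp.
  apply Rle_trans with (eps * ((w + h) ^ 2 / 2)); [simpl; lra|].
  apply Rmult_le_compat_l; [lra|].
  pose proof (pow2_ge_0 (w - h)); simpl in *; lra.
Qed.

(** * Circular means and Schwarz's lemma *)

Lemma ex_Cderive_continuous (f : C -> C) (z : C) : ex_Cderive f z -> Ccontinuous f z.
Proof. intros [l Hl]; exact (is_Cderive_continuous f z l Hl). Qed.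

Lemma Ccontinuous_mult (f g : C -> C) (z : C) :
  Ccontinuous f z -> Ccontinuous g z -> Ccontinuous (fun y => f y * g y)%C z.
Proof.
intros Hf Hg eps He.
pose proof (Cmod_ge_0 (f z)) as Pf; pose proof (Cmod_ge_0 (g z)) as Pg.
set (k := 1 + Cmod (f z) + Cmod (g z)).
set (e := Rmin 1 (eps / (2 * k))).
assert (Hk : 0 < k) by (unfold k; lra).
assert (He' : 0 < e) by (apply Rmin_glb_lt; [lra | apply Rdiv_lt_0_compat; lra]).
assert (E1 : e <= 1) by apply Rmin_l.
assert (E2 : e * k <= eps / 2).
{ apply Rle_trans with (eps / (2 * k) * k).
  - apply Rmult_le_compat_r; [lra | apply Rmin_r].
  - apply Req_le; field; lra. }
destruct (Hf e He') as [d1 [D1 K1]]; destruct (Hg e He') as [d2 [D2 K2]].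
exists (Rmin d1 d2); split; [apply Rmin_glb_lt; assumption|].
intros y Hy.
pose proof (K1 y (Rlt_le_trans _ _ _ Hy (Rmin_l _ _))) as F.
pose proof (K2 y (Rlt_le_trans _ _ _ Hy (Rmin_r _ _))) as G.
replace (f y * g y - f z * g z)%C with
  ((f y - f z) * (g y - g z) + (f z * (g y - g z) + (f y - f z) * g z))%C by ring.
eapply Rle_lt_trans; [apply Cmod_triangle|].
eapply Rle_lt_trans; [apply Rplus_le_compat_l, Cmod_triangle|].
rewrite !Cmod_mult.
pose proof (Cmod_ge_0 (f y - f z)); pose proof (Cmod_ge_0 (g y - g z)).
assert (Cmod (f y - f z) * Cmod (g y - g z) <= e * 1) by (apply Rmult_le_compat; lra).
assert (Cmod (f z) * Cmod (g y - g z) <= Cmod (f z) * e) by (apply Rmult_le_compat_l; lra).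
assert (Cmod (f y - f z) * Cmod (g z) <= e * Cmod (g z)) by (apply Rmult_le_compat_r; lra).
unfold k in E2; lra.
Qed.

Lemma Cexp_continuity_2d (f : C -> C) (s t : R) : Ccontinuous f (Cexp (s, t)) ->
  continuity_2d_pt (fun s t => Re (f (Cexp (s, t)))) s t.
Proof.
intros Hf eps.
destruct (Hf eps (cond_pos eps)) as [d [Hd K]].
destruct (is_Cderive_continuous _ _ _ (is_Cderive_exp (s, t)) d Hd) as [e [He L]].
assert (S2 : 0 < sqrt 2) by (apply sqrt_lt_R0; lra).
assert (He' : 0 < e / sqrt 2) by (apply Rdiv_lt_0_compat; assumption).
exists (mkposreal _ He'); simpl; intros u v Hu Hv.
eapply Rle_lt_trans; [|apply (K (Cexp (u, v))), L].
- eapply Rle_trans; [|apply re_le_Cmod].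
  apply Req_le; f_equal; simpl; ring.
- eapply Rle_lt_trans; [apply Cmod_2Rmax|].
  apply Rlt_le_trans with (sqrt 2 * (e / sqrt 2)); [|apply Req_le; field; lra].
  apply Rmult_lt_compat_l; [exact S2 | apply Rmax_lub_lt; assumption].
Qed.

(** Up to the factor 2 PI, the mean of Re f over the circle with log-radius [s]. *)
Definition circle_mean (f : C -> C) (s : R) : R :=
  RInt (fun t => Re (f (Cexp (s, t)))) 0 (2 * PI).

Lemma circle_mean_ex (f : C -> C) (s : R) : (forall t, Ccontinuous f (Cexp (s, t))) ->
  ex_RInt (fun t => Re (f (Cexp (s, t)))) 0 (2 * PI).
Proof.
intros Hf; apply (ex_RInt_continuous (V := R_CompleteNormedModule)); intros t _.
apply (continuity_2d_pt_sections (fun s t => Re (f (Cexp (s, t)))) s t).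
apply Cexp_continuity_2d, Hf.
Qed.

Lemma circle_mean_bound (f : C -> C) (s B : R) : (forall t, Ccontinuous f (Cexp (s, t))) ->
  (forall t, Cmod (f (Cexp (s, t))) <= B) -> Rabs (circle_mean f s) <= 2 * PI * B.
Proof.
intros Hf HB; pose proof PI_RGT_0.
replace (2 * PI * B) with ((2 * PI - 0) * B) by ring.
apply abs_RInt_le_const; [lra | apply circle_mean_ex; exact Hf|].
intros t _; eapply Rle_trans; [apply re_le_Cmod | apply HB].
Qed.

(** With F = f o [Cexp], the form Im F ds + Re F dt is closed by Cauchy-Riemann, and the horizontal
    sides of the rectangle cancel by periodicity. *)
Lemma circle_mean_const (f : C -> C) (s1 s2 : R) : s1 <= s2 ->
  (forall s t, s1 <= s <= s2 -> ex_Cderive f (Cexp (s, t))) ->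
  circle_mean f s1 = circle_mean f s2.
Proof.
intros Hs Hf; pose proof PI_RGT_0.
assert (G := goursat (fun s t => Im (f (Cexp (s, t)))) (fun s t => Re (f (Cexp (s, t))))
  s1 s2 0 (2 * PI) Hs ltac:(lra)).
assert (E : RInt (fun s => Im (f (Cexp (s, 2 * PI)))) s1 s2 =
  RInt (fun s => Im (f (Cexp (s, 0)))) s1 s2).
{ apply RInt_ext; intros s _; unfold Cexp; simpl.
  rewrite cos_2PI, sin_2PI, cos_0, sin_0; reflexivity. }
cbv beta in G; rewrite E, Rminus_diag in G; unfold circle_mean.
symmetry; apply Rminus_diag_uniq; symmetry; apply G; clear G E.
intros s t Hst _; destruct (Hf s t Hst) as [l Hl].
destruct (is_Cderive_differentiable _ _ _ _
  (is_Cderive_comp f Cexp (s, t) _ _ Hl (is_Cderive_exp (s, t)))) as [D1 D2].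
eexists _, _, _; split; [exact D2 | exact D1].
Qed.

Lemma circle_mean_continuous (f : C -> C) (a b s0 : R) : a < s0 < b ->
  (forall s t, a <= s <= b -> Ccontinuous f (Cexp (s, t))) ->
  forall eps, 0 < eps -> exists d, 0 < d /\ forall s, Rabs (s - s0) < d ->
    Rabs (circle_mean f s - circle_mean f s0) <= eps.
Proof.
intros Hs0 Hf eps He; pose proof PI_RGT_0.
assert (He' : 0 < eps / (2 * PI)) by (apply Rdiv_lt_0_compat; lra).
destruct (uniform_continuity_2d (fun s t => Re (f (Cexp (s, t)))) a b 0 (2 * PI)
  (fun s t Hs _ => Cexp_continuity_2d f s t (Hf s t Hs)) (mkposreal _ He')) as [d Hd].
simpl in Hd.
exists (Rmin d (Rmin (s0 - a) (b - s0))); split.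
{ repeat apply Rmin_glb_lt; [apply cond_pos | lra | lra]. }
intros s Hs.
assert (B1 := Rlt_le_trans _ _ _ Hs (Rmin_l _ _)).
assert (B2 := Rlt_le_trans _ _ _ Hs (Rmin_r _ _)).
assert (B3 := Rlt_le_trans _ _ _ B2 (Rmin_l _ _)).
assert (B4 := Rlt_le_trans _ _ _ B2 (Rmin_r _ _)).
apply Rabs_lt_between in B3; apply Rabs_lt_between in B4.
assert (X : forall s, a <= s <= b -> ex_RInt (fun t => Re (f (Cexp (s, t)))) 0 (2 * PI))
  by (intros; apply circle_mean_ex; intros; apply Hf; assumption).
unfold circle_mean; rewrite <- RInt_Rminus by (apply X; lra).
replace eps with ((2 * PI - 0) * (eps / (2 * PI))) by (field; lra).
apply abs_RInt_le_const; [lra | apply (ex_RInt_minus (V := R_NormedModule)); apply X; lra|].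
intros t Ht; apply Rlt_le, Hd; try lra.
rewrite Rminus_diag, Rabs_R0; apply cond_pos.
Qed.

Lemma Rabs_le_all_eq_0 (x : R) : (forall eps, 0 < eps -> Rabs x <= eps) -> x = 0.
Proof.
intros H; apply Rabs_eq_0, Rle_antisym; [|apply Rabs_pos].
apply le_epsilon; intros eps He; rewrite Rplus_0_l; exact (H eps He).
Qed.

(* Differentiability may fail on the circle of log-radius [sigma]: there
   continuity alone lets the constant value of the mean pass across. *)
Lemma circle_mean_eq_0 (f : C -> C) (sigma S s1 K : R) : 0 <= K -> s1 < S ->
  (forall s t, s < S -> Ccontinuous f (Cexp (s, t))) ->
  (forall s t, s < S -> s <> sigma -> ex_Cderive f (Cexp (s, t))) ->
  (forall s t, s < s1 -> Cmod (f (Cexp (s, t))) <= K * exp s) ->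
  forall s, s < S -> circle_mean f s = 0.
Proof.
intros HK Hs1 Hc Hd HB; pose proof PI_RGT_0.
(* Below [sigma] the mean is constant, so it can be evaluated at a log-radius where K exp s' is as
   small as desired. *)
assert (Low : forall s, s < S -> s < sigma -> circle_mean f s = 0).
{ intros s HsS Hs; apply Rabs_le_all_eq_0; intros eps He.
  set (e := eps / (1 + 2 * PI * K)).
  assert (0 <= 2 * PI * K) by (apply Rmult_le_pos; lra).
  assert (He' : 0 < e) by (apply Rdiv_lt_0_compat; lra).
  assert (exists s', s' <= s /\ s' < s1 /\ exp s' <= e) as (s' & L1 & L2 & L3).
  { exists (Rmin s (Rmin (s1 - 1) (ln e))).
    pose proof (Rmin_l s (Rmin (s1 - 1) (ln e))).
    pose proof (Rmin_r s (Rmin (s1 - 1) (ln e))).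
    pose proof (Rmin_l (s1 - 1) (ln e)); pose proof (Rmin_r (s1 - 1) (ln e)).
    repeat split; try lra.
    apply Rnot_lt_le; intros N; apply ln_increasing in N; [|exact He'].
    rewrite ln_exp in N; lra. }
  rewrite <- (circle_mean_const f s' s L1) by (intros; apply Hd; lra).
  eapply Rle_trans.
  - apply (circle_mean_bound f s' (K * exp s')); intros t; [apply Hc; lra | apply HB, L2].
  - apply Rle_trans with (2 * PI * K * e).
      rewrite <- Rmult_assoc; apply Rmult_le_compat_l; lra.
    apply Rle_trans with ((1 + 2 * PI * K) * e).
      apply Rmult_le_compat_r; lra.
    apply Req_le; unfold e; field; lra. }
assert (Cont : sigma < S -> forall eps, 0 < eps -> exists d, 0 < d /\
  forall s, Rabs (s - sigma) < d ->
    Rabs (circle_mean f s - circle_mean f sigma) <= eps).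
{ intros HS; apply (circle_mean_continuous f (sigma - 1) ((sigma + S) / 2)); [lra|].
  intros; apply Hc; lra. }
assert (Mid : sigma < S -> circle_mean f sigma = 0).
{ intros HS; apply Rabs_le_all_eq_0; intros eps He.
  destruct (Cont HS eps He) as [d [D K']].
  specialize (K' (sigma - d / 2)).
  rewrite Low in K' by lra.
  rewrite Rminus_0_l, Rabs_Ropp in K'; apply K'.
  rewrite Rabs_left; lra. }
intros s Hs; destruct (Rtotal_order s sigma) as [L | [-> | L]].
- apply Low; assumption.
- apply Mid; exact Hs.
- assert (HS : sigma < S) by lra.
  apply Rabs_le_all_eq_0; intros eps He.
  destruct (Cont HS eps He) as [d [D K']].
  (* The mean agrees at [s'] and [s], both above [sigma], and [s'] is close enough to [sigma] for
     [Cont]. *)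
  set (s' := Rmin s (sigma + d / 2)).
  assert (S1 : s' <= s) by apply Rmin_l.
  assert (S2 : s' <= sigma + d / 2) by apply Rmin_r.
  assert (S3 : sigma < s') by (apply Rmin_glb_lt; lra).
  rewrite <- (circle_mean_const f s' s S1) by (intros; apply Hd; lra).
  specialize (K' s'); rewrite (Mid HS), Rminus_0_r in K'.
  apply K'; rewrite Rabs_pos_eq; lra.
Qed.

(** The map u -> 1/(1 - u) sends the unit disk into the half plane Re > 1/2; here u = a/z. After
    clearing |z - a|^2 the claim is |a|^2 <= |z|^2. *)
Lemma Re_div_minus_ge (z a : C) : Cmod a < Cmod z -> / 2 <= Re (z / (z - a))%C.
Proof.
intros H.
assert (H2 : Cmod a ^ 2 < Cmod z ^ 2).
{ pose proof (Cmod_ge_0 a); simpl; rewrite !Rmult_1_r; apply Rmult_le_0_lt_compat; lra. }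
rewrite !Cmod2_alt in H2.
destruct z as [x y], a as [u v]; cbn [Re Im fst snd] in H2.
unfold Cdiv, Cinv, Cmult, Cminus, Cplus, Copp, Re; cbn [fst snd].
set (n := (x + - u) ^ 2 + (y + - v) ^ 2).
assert (Hn : 0 < n).
{ unfold n; pose proof (pow2_ge_0 (x + - u)); pose proof (pow2_ge_0 (y + - v)).
  destruct (Req_dec (x + - u) 0) as [E1 | E1]; [|pose proof (pow2_gt_0 _ E1); lra].
  destruct (Req_dec (y + - v) 0) as [E2 | E2]; [|pose proof (pow2_gt_0 _ E2); lra].
  replace u with x in H2 by lra; replace v with y in H2 by lra; lra. }
apply Rmult_le_reg_r with n; [exact Hn|].
replace ((x * ((x + - u) / n) - y * (- (y + - v) / n)) * n)
  with (x * (x + - u) + y * (y + - v)) by (field; lra).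
unfold n; simpl in *; lra.
Qed.

Lemma Cmod_minus_ge (z a : C) : Cmod z - Cmod a <= Cmod (z - a).
Proof.
pose proof (Cmod_triangle (z - a) a) as T.
replace (z - a + a)%C with z in T by ring; lra.
Qed.

(* Integrate [c z (f z - f a) / (z - a)] over the circle [|z| = r], where [c f a = |f a|]. *)
Lemma cauchy_estimate (f : C -> C) (a : C) (r M B d : R) :
  (forall z, 0 < Cmod z < 1 -> ex_Cderive f z) ->
  0 < d -> (forall z, 0 < Cmod z < d -> Cmod (f z) <= B) ->
  0 < Cmod a < r -> r < 1 -> (forall z, Cmod z = r -> Cmod (f z) <= M) ->
  Cmod (f a) <= 2 * (M * r / (r - Cmod a)).
Proof.
intros Hf Hd HB Ha Hr HM.
set (A := Cmod a) in *.
assert (HM0 : 0 <= M).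
{ eapply Rle_trans; [apply Cmod_ge_0 | apply (HM (RtoC r))].
  rewrite Cmod_R; apply Rabs_pos_eq; lra. }
assert (HMr : 0 <= M * r / (r - A)).
{ apply Rmult_le_pos; [apply Rmult_le_pos; lra | apply Rlt_le, Rinv_0_lt_compat; lra]. }
destruct (Req_dec (Cmod (f a)) 0) as [E0 | E0]; [lra|].
assert (Pfa : 0 < Cmod (f a)) by (pose proof (Cmod_ge_0 (f a)); lra).
set (c := (Cconj (f a) / Cmod (f a))%C).
assert (Nfa : RtoC (Cmod (f a)) <> 0%C) by (intros E; injection E; lra).
assert (Hc : Cmod c = 1).
{ unfold c; rewrite Cmod_div, Cmod_conj, Cmod_R, Rabs_pos_eq by (try exact Nfa; lra).
  field; lra. }
assert (Hca : (c * f a)%C = Cmod (f a)).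
{ unfold c; replace (Cconj (f a) / Cmod (f a) * f a)%C
    with ((f a * Cconj (f a)) / Cmod (f a))%C by (field; exact Nfa).
  rewrite <- Cmod2_conj, RtoC_pow; field; exact Nfa. }
destruct (Hf a) as [l Hl]; [fold A; lra|].
(* The difference quotient, completed by the derivative. At [a] only its continuity is established,
   so |z| = |a| is the exceptional circle in [circle_mean_eq_0]. *)
set (q := fun z => if Ceq_dec z a then l else ((f z - f a) / (z - a))%C).
set (H := fun z => (c * z * q z)%C).
assert (Dm : forall z y, y <> z -> 0 < Cmod (y - z)).
{ intros z y E; apply Cmod_gt_0; intros E2; apply E.
  replace y with (y - z + z)%C by ring; rewrite E2; ring. }
assert (Nm : forall z y, y <> z -> (y - z)%C <> 0%C)
  by (intros z y E; apply Cmod_gt_0, Dm, E).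
assert (qc : Ccontinuous q a).
{ intros eps He.
  destruct (proj1 (is_Cderive_eps f a l) Hl (eps / 2)) as [e [E1 E2]]; [lra|].
  exists e; split; [exact E1|]; intros y Hy.
  unfold q; destruct (Ceq_dec a a) as [_ | X]; [|congruence].
  destruct (Ceq_dec y a) as [_ | X].
  - replace (l - l)%C with (RtoC 0) by ring; rewrite Cmod_0; exact He.
  - replace ((f y - f a) / (y - a) - l)%C
      with ((f y - f a - (y - a) * l) / (y - a))%C by (field; apply Nm, X).
    rewrite Cmod_div by (apply Nm, X).
    apply Rle_lt_trans with (eps / 2); [|lra].
    apply Rmult_le_reg_r with (Cmod (y - a)); [apply Dm, X|].
    unfold Rdiv at 1; rewrite Rmult_assoc, Rinv_l by (apply Rgt_not_eq, Dm, X).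
    rewrite Rmult_1_r; apply E2, Hy. }
assert (Hder : forall z, 0 < Cmod z < 1 -> z <> a -> ex_Cderive H z).
{ intros z Hz Hza; destruct (Hf z Hz) as [lz Hlz].
  eexists; apply (is_Cderive_ext_loc (fun y => c * y * ((f y - f a) / (y - a)))%C
    H z _ (Cmod (z - a))); [apply Dm, Hza | |].
  - intros y Hy; unfold H, q; destruct (Ceq_dec y a) as [-> | _]; [|reflexivity].
    exfalso; replace (a - z)%C with (- (z - a))%C in Hy by ring.
    rewrite Cmod_opp in Hy; lra.
  - apply (is_Cderive_mult (fun y => c * y)%C (fun y => (f y - f a) / (y - a))%C).
    + apply (is_Cderive_mult (fun _ => c) (fun y => y));
        [apply is_Cderive_const | apply is_Cderive_id].
    + apply (is_Cderive_div (fun y => f y - f a)%C (fun y => y - a)%C);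
        [apply Nm, Hza | |].
      * apply is_Cderive_minus; [exact Hlz | apply is_Cderive_const].
      * apply is_Cderive_minus; [apply is_Cderive_id | apply is_Cderive_const]. }
assert (Hcont : forall z, 0 < Cmod z < 1 -> Ccontinuous H z).
{ intros z Hz; destruct (Ceq_dec z a) as [-> | Hza].
  - apply (Ccontinuous_mult (fun y => c * y)%C q); [|exact qc].
    apply ex_Cderive_continuous; eexists.
    apply (is_Cderive_mult (fun _ => c) (fun y => y));
        [apply is_Cderive_const | apply is_Cderive_id].
  - apply ex_Cderive_continuous, Hder; assumption. }
assert (Ring : forall s t, s < 0 -> 0 < Cmod (Cexp (s, t)) < 1).
{ intros s t Hs; rewrite Cmod_Cexp; cbn [Re fst]; split; [apply exp_pos|].
  rewrite <- exp_0; apply exp_increasing, Hs. }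
assert (HB0 : 0 <= B).
{ eapply Rle_trans; [apply Cmod_ge_0 | apply (HB (RtoC (d / 2)))].
  rewrite Cmod_R, Rabs_pos_eq; lra. }
(* For |z| < min(d, A/2) the numerator of [q] is at most B + |f a| and |z - a| >= A/2, which gives
   the constant; the -1 keeps the log-radius negative. *)
assert (Zero : circle_mean H (ln r) = 0).
{ apply (circle_mean_eq_0 H (ln A) 0 (Rmin (- 1) (ln (Rmin d (A / 2))))
    ((B + Cmod (f a)) / (A / 2))).
  - apply Rmult_le_pos; [lra | apply Rlt_le, Rinv_0_lt_compat; lra].
  - eapply Rle_lt_trans; [apply Rmin_l | lra].
  - intros s t Hs; apply Hcont, Ring, Hs.
  - intros s t Hs Hsa; apply Hder; [apply Ring, Hs|].
    intros E; apply Hsa; unfold A; rewrite <- E, Cmod_Cexp; symmetry; apply ln_exp.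
  - intros s t Hs.
    assert (Hm : 0 < Rmin d (A / 2)) by (apply Rmin_glb_lt; lra).
    assert (Hs' : s < ln (Rmin d (A / 2)))
      by exact (Rlt_le_trans _ _ _ Hs (Rmin_r _ _)).
    apply exp_increasing in Hs'; rewrite exp_ln in Hs' by exact Hm.
    assert (E1 := Rlt_le_trans _ _ _ Hs' (Rmin_l _ _)).
    assert (E2 := Rlt_le_trans _ _ _ Hs' (Rmin_r _ _)).
    assert (Ez : Cmod (Cexp (s, t)) = exp s) by apply Cmod_Cexp.
    set (z := Cexp (s, t)) in *; rewrite <- Ez in *.
    assert (P0 : 0 < Cmod z) by (rewrite Ez; apply exp_pos).
    assert (Hza : z <> a) by (intros E; rewrite E in E2; fold A in E2; lra).
    unfold H, q; destruct (Ceq_dec z a) as [X | _]; [contradiction|].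
    rewrite !Cmod_mult, Cmod_div, Hc, Rmult_1_l, Rmult_comm by (apply Nm, Hza).
    apply Rmult_le_compat_r; [lra|].
    apply Rmult_le_compat.
    + apply Cmod_ge_0.
    + apply Rlt_le, Rinv_0_lt_compat, Dm, Hza.
    + eapply Rle_trans; [apply Cmod_triangle|]; rewrite Cmod_opp.
      apply Rplus_le_compat_r, HB; lra.
    + apply Rinv_le_contravar; [lra|].
      replace (z - a)%C with (- (a - z))%C by ring; rewrite Cmod_opp.
      pose proof (Cmod_minus_ge a z) as T; fold A in T; lra.
  - rewrite <- ln_1; apply ln_increasing; lra. }
(* The part of the integrand with f z is at most M r / (r - A), and the part with f a subtracts at
   least |f a|/2. The pointwise bound 1/2, in place of the true mean 1 of z/(z - a), is the source
   of the factor 2. *)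
assert (Up : circle_mean H (ln r) <= (2 * PI - 0) * (M * r / (r - A) - Cmod (f a) * / 2)).
{ pose proof PI_RGT_0.
  rewrite <- RInt_Rconst; unfold circle_mean; apply RInt_le; [lra | | |].
  - apply circle_mean_ex; intros t; apply Hcont, Ring; rewrite <- ln_1.
    apply ln_increasing; lra.
  - apply (ex_RInt_const (V := R_NormedModule)).
  - intros t _.
    assert (Ez : Cmod (Cexp (ln r, t)) = r)
      by (rewrite Cmod_Cexp; cbn [Re fst]; apply exp_ln; lra).
    set (z := Cexp (ln r, t)) in *.
    assert (Hza : z <> a) by (intros E; rewrite E in Ez; fold A in Ez; lra).
    unfold H, q; destruct (Ceq_dec z a) as [X | _]; [contradiction|].
    replace (c * z * ((f z - f a) / (z - a)))%C
      with (c * (f z * z / (z - a)) - (c * f a) * (z / (z - a)))%C by (field; apply Nm, Hza).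
    rewrite Hca.
    replace (Re (c * (f z * z / (z - a)) - Cmod (f a) * (z / (z - a)))%C)
      with (Re (c * (f z * z / (z - a)))%C - Cmod (f a) * Re (z / (z - a))%C)
      by (destruct (c * (f z * z / (z - a)))%C, (z / (z - a))%C; simpl; ring).
    assert (T1 : Re (c * (f z * z / (z - a)))%C <= M * r / (r - A)).
    { eapply Rle_trans; [apply Rle_abs|]; eapply Rle_trans; [apply re_le_Cmod|].
      rewrite Cmod_mult, Hc, Rmult_1_l, Cmod_div, Cmod_mult, Ez by (apply Nm, Hza).
      apply Rmult_le_compat.
      - apply Rmult_le_pos; [apply Cmod_ge_0 | lra].
      - apply Rlt_le, Rinv_0_lt_compat, Dm, Hza.
      - apply Rmult_le_compat_r; [lra | apply HM, Ez].
      - apply Rinv_le_contravar; [lra|].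
        pose proof (Cmod_minus_ge z a) as T; fold A in T; lra. }
    assert (T2 : / 2 <= Re (z / (z - a))%C)
      by (apply Re_div_minus_ge; fold A; lra).
    assert (Cmod (f a) * / 2 <= Cmod (f a) * Re (z / (z - a))%C)
      by (apply Rmult_le_compat_l; lra).
    lra. }
rewrite Zero in Up; pose proof PI_RGT_0.
apply Rnot_lt_le; intros N.
assert (0 < (2 * PI - 0) * (Cmod (f a) * / 2 - M * r / (r - A)))
  by (apply Rmult_lt_0_compat; lra).
lra.
Qed.

Lemma pow_bounded_le_1 (x K : R) : 0 <= x -> (forall n : nat, x ^ n <= K) -> x <= 1.
Proof.
intros Hx H; apply Rnot_lt_le; intros N.
destruct (Pow_x_infinity x) with (b := K + 1) as [n Hn].
- rewrite Rabs_pos_eq; lra.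
- specialize (Hn n (Nat.le_refl n)); specialize (H n).
  rewrite Rabs_pos_eq in Hn by (apply pow_le; exact Hx); lra.
Qed.

(* Applying the estimate to the powers of [w z / z] removes its constant. *)
Lemma schwarz_lemma (w : C -> C) : analytic w -> w 0%C = 0%C ->
  (forall z, in_disk z -> in_disk (w z)) ->
  forall z, in_disk z -> Cmod (w z) <= Cmod z.
Proof.
unfold in_disk; intros Hw w0 Hdisk a Ha.
destruct (Ceq_dec a 0%C) as [-> | Na]; [rewrite w0; lra|].
assert (Pa : 0 < Cmod a) by (apply Cmod_gt_0, Na).
assert (Nz : forall z, 0 < Cmod z -> z <> 0%C) by (intros; apply Cmod_gt_0; assumption).
destruct (Hw 0%C) as [l Hl]; [unfold in_disk; rewrite Cmod_0; lra|].
destruct (proj1 (is_Cderive_eps _ _ _) Hl 1 Rlt_0_1) as [d [Hd Hd']].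
(* All powers of (|w a| / |a|) r share the bound 2 r / (r - |a|), which is free of the exponent. *)
assert (Key : forall r, Cmod a < r -> r < 1 -> Cmod (w a) / Cmod a * r <= 1).
{ intros r Hr1 Hr2.
  apply (pow_bounded_le_1 _ (2 * (r / (r - Cmod a)))).
  { apply Rmult_le_pos; [|lra]; apply Rmult_le_pos; [apply Cmod_ge_0|].
    apply Rlt_le, Rinv_0_lt_compat, Pa. }
  intros n.
  (* On |z| = r the quotient w z / z is at most 1/r in modulus; near 0 the derivative [l] bounds it
     by |l| + 1. *)
  assert (E := cauchy_estimate (fun z => (w z / z) ^ n)%C a r ((/ r) ^ n)
    ((Cmod l + 1) ^ n) d).
  cbv beta in E; rewrite Cmod_pow, Cmod_div in E by exact Na.
  rewrite Rpow_mult_distr.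
  apply Rle_trans with (2 * ((/ r) ^ n * r / (r - Cmod a)) * r ^ n).
  - apply Rmult_le_compat_r; [apply pow_le; lra|].
    apply E; clear E; auto.
    + intros z Hz; destruct (Hw z) as [lz Hlz]; [apply Hz|].
      eapply is_Cderive_pow, (is_Cderive_div w (fun y => y)); [apply Nz, Hz | exact Hlz|].
      apply is_Cderive_id.
    + intros z Hz; rewrite Cmod_pow, Cmod_div by (apply Nz, Hz).
      apply pow_incr; split.
        apply Rmult_le_pos; [apply Cmod_ge_0|]; apply Rlt_le, Rinv_0_lt_compat, Hz.
      apply Rmult_le_reg_r with (Cmod z); [apply Hz|].
      unfold Rdiv; rewrite Rmult_assoc, Rinv_l, Rmult_1_r by lra.
      assert (T := Hd' z); rewrite w0 in T.
      replace (z - 0)%C with z in T by ring.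
      replace (w z - 0 - z * l)%C with (w z - z * l)%C in T by ring.
      specialize (T (proj2 Hz)).
      pose proof (Cmod_minus_ge (w z) (z * l)) as T2; rewrite Cmod_mult in T2; lra.
    + intros z Hz; rewrite Cmod_pow, Cmod_div, Hz by (apply Nz; lra).
      apply pow_incr; split.
        apply Rmult_le_pos; [apply Cmod_ge_0|]; apply Rlt_le, Rinv_0_lt_compat; lra.
      rewrite <- (Rmult_1_l (/ r)).
      apply Rmult_le_compat_r; [apply Rlt_le, Rinv_0_lt_compat; lra|].
      apply Rlt_le, Hdisk; lra.
  - apply Req_le; rewrite pow_inv; field; split; [lra | apply pow_nonzero; lra]. }
apply Rnot_lt_le; intros N.
assert (W : Cmod (w a) < 1) by (apply Hdisk, Ha).
set (x := Cmod a) in *; set (y := Cmod (w a)) in *.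
(* Any radius between x/y and 1 contradicts [Key], and y < 1 puts it above x = |a| as [Key] demands;
   the midpoint is taken. *)
assert (Hxy : x < x / y < 1).
{ split.
  - apply Rmult_lt_reg_r with y; [lra|].
    unfold Rdiv; rewrite Rmult_assoc, Rinv_l by lra.
    apply Rmult_lt_compat_l; lra.
  - apply Rmult_lt_reg_r with y; [lra|].
    unfold Rdiv; rewrite Rmult_assoc, Rinv_l by lra; lra. }
specialize (Key ((1 + x / y) / 2) ltac:(lra) ltac:(lra)).
replace (y / x * ((1 + x / y) / 2)) with ((y / x + 1) / 2) in Key by (field; lra).
assert (1 < y / x).
{ apply Rmult_lt_reg_r with x; [lra|].
  unfold Rdiv; rewrite Rmult_assoc, Rinv_l by lra; lra. }
lra.
Qed.

(** * Inversion of the nephroid function *)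

Lemma RtoC_neq_0 (x : R) : x <> 0 -> RtoC x <> 0%C.
Proof. intros H E; apply H; injection E; trivial. Qed.

(** The contraction constant of the iteration below: a^2 + ab + b^2 has three terms of modulus at
    most rho^2, against the factor 1/3. *)
Lemma Cmod_cube_minus (a b : C) (rho : R) : Cmod a <= rho -> Cmod b <= rho ->
  Cmod (a ^ 3 / 3 - b ^ 3 / 3) <= rho ^ 2 * Cmod (a - b).
Proof.
intros Ha Hb.
pose proof (Cmod_ge_0 a); pose proof (Cmod_ge_0 b).
replace (a ^ 3 / 3 - b ^ 3 / 3)%C with ((a * a + (a * b + b * b)) / 3 * (a - b))%C
  by (field; apply RtoC_neq_0; lra).
rewrite Cmod_mult, Cmod_div, Cmod_R, (Rabs_pos_eq 3) by (try apply RtoC_neq_0; lra).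
apply Rmult_le_compat_r; [apply Cmod_ge_0|].
assert (T : Cmod (a * a + (a * b + b * b)) <= rho * rho + (rho * rho + rho * rho)).
{ eapply Rle_trans; [apply Cmod_triangle|].
  apply Rplus_le_compat; [|eapply Rle_trans; [apply Cmod_triangle|]; apply Rplus_le_compat];
    rewrite Cmod_mult; apply Rmult_le_compat; lra. }
simpl; lra.
Qed.

(** The increments form a series dominated by a geometric one, and its partial sums telescope. *)
Lemma Cseries_cauchy_limit (x : nat -> C) (q : R) : 0 <= q < 1 ->
  (forall n, Cmod (x (S n) - x n) <= q ^ n) ->
  exists l, forall eps, 0 < eps -> exists N, forall n, (N <= n)%nat -> Cmod (x n - l) < eps.
Proof.
intros Hq Hx.
assert (Ser : ex_series (K := C_AbsRing) (V := C_CompleteNormedModule)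
  (fun n => x (S n) - x n)%C).
{ apply ex_series_le with (fun n => q ^ n); [exact Hx|].
  exists (/ (1 - q)); apply is_series_geom; rewrite Rabs_pos_eq; lra. }
destruct Ser as [l Hl].
assert (Sum : forall n, sum_n (G := C_AbelianMonoid) (fun n => x (S n) - x n)%C n
  = (x (S n) - x 0%nat)%C).
{ induction n as [|n IH].
  - apply sum_O.
  - rewrite sum_Sn, IH; unfold plus; simpl; ring. }
exists (l + x 0%nat)%C; intros eps He.
assert (L := Hl (fun y => Cmod (y - l)%C < eps)); destruct L as [N HN].
{ apply (locally_le_locally_norm (V := C_NormedModule)).
  exists (mkposreal eps He); intros y Hy; exact Hy. }
exists (S N); intros [|n] Hn; [lia|].
specialize (HN n ltac:(lia)).
change (Cmod (sum_n (G := C_AbelianMonoid) (fun n => x (S n) - x n)%C n - l)%C < eps) in HN.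
rewrite Sum in HN.
replace (x (S n) - (l + x 0%nat))%C with (x (S n) - x 0%nat - l)%C by ring; exact HN.
Qed.

(* Banach iteration of [omega |-> zeta + omega^3 / 3] on the disk of radius [rho],
   where [|zeta| <= rho - rho^3 / 3]. *)
Lemma nephroid_preimage (zeta : C) : Cmod zeta < 2 / 3 ->
  exists omega, Cmod omega < 1 /\ (omega - omega ^ 3 / 3)%C = zeta.
Proof.
intros Hz; pose proof (Cmod_ge_0 zeta) as Pz.
(* This radius is invariant, as rho - rho^3/3 - |zeta| = m (1 - m) + m^3/3 >= 0, and rho < 1 makes
   the map a contraction. *)
set (m := 2 / 3 - Cmod zeta); set (rho := 1 - m).
assert (Hm : 0 < m <= 2 / 3) by (unfold m; lra).
assert (Hrho : 0 < rho < 1) by (unfold rho; lra).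
assert (Hself : Cmod zeta + rho ^ 3 / 3 <= rho).
{ replace (Cmod zeta) with (2 / 3 - m) by (unfold m; ring).
  unfold rho; assert (0 <= m * (1 - m)) by (apply Rmult_le_pos; lra).
  assert (0 < m ^ 3) by (apply pow_lt; lra); simpl in *; lra. }
set (x := fix x n := match n with O => RtoC 0 | S n => (zeta + x n ^ 3 / 3)%C end).
assert (Ex : forall n, x (S n) = (zeta + x n ^ 3 / 3)%C) by reflexivity.
assert (Bx : forall n, Cmod (x n) <= rho).
{ induction n as [|n IH].
  - simpl; rewrite Cmod_0; lra.
  - rewrite Ex.
    eapply Rle_trans; [apply Cmod_triangle|].
    rewrite Cmod_div, Cmod_pow, Cmod_R, (Rabs_pos_eq 3) by (try apply RtoC_neq_0; lra).
    assert (Cmod (x n) ^ 3 <= rho ^ 3) by (apply pow_incr; split; [apply Cmod_ge_0 | exact IH]).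
    lra. }
assert (Dx : forall n, Cmod (x (S n) - x n) <= (rho ^ 2) ^ n).
{ induction n as [|n IH].
  - simpl pow; eapply Rle_trans; [|apply Rlt_le, Hrho].
    replace (x 1%nat - x 0%nat)%C with (x 1%nat)
      by (change (x 0%nat) with (RtoC 0); ring); apply Bx.
  - rewrite (Ex (S n)).
    replace (zeta + x (S n) ^ 3 / 3 - x (S n))%C
      with (x (S n) ^ 3 / 3 - x n ^ 3 / 3)%C by (rewrite (Ex n); ring).
    eapply Rle_trans; [apply (Cmod_cube_minus _ _ rho); apply Bx|].
    apply Rmult_le_compat_l; [apply pow_le; lra | exact IH]. }
destruct (Cseries_cauchy_limit x (rho ^ 2)) as [l Hl]; [|exact Dx|].
{ split; [apply pow_le; lra|]; simpl; nra. }
assert (Bl : Cmod l <= rho).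
{ apply le_epsilon; intros eps He; destruct (Hl eps He) as [N HN].
  specialize (HN N (Nat.le_refl N)).
  pose proof (Cmod_minus_ge l (x N)) as T.
  replace (l - x N)%C with (- (x N - l))%C in T by ring; rewrite Cmod_opp in T.
  specialize (Bx N); lra. }
exists l; split; [lra|].
enough (E : Cmod (l - l ^ 3 / 3 - zeta)%C = 0).
{ apply Cmod_eq_0 in E; replace zeta with (l - l ^ 3 / 3 - (l - l ^ 3 / 3 - zeta))%C by ring.
  rewrite E; ring. }
apply Rabs_le_all_eq_0; intros eps He; rewrite Rabs_pos_eq by apply Cmod_ge_0.
destruct (Hl (eps / 2)) as [N HN]; [lra|].
assert (H1 := HN N (Nat.le_refl N)); assert (H2 := HN (S N) ltac:(lia)).
replace (l - l ^ 3 / 3 - zeta)%C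
  with (- (x (S N) - l) + (x N ^ 3 / 3 - l ^ 3 / 3))%C by (rewrite (Ex N); ring).
eapply Rle_trans; [apply Cmod_triangle|]; rewrite Cmod_opp.
pose proof (Cmod_cube_minus (x N) l rho (Bx N) Bl) as T.
assert (rho ^ 2 * Cmod (x N - l) <= 1 * Cmod (x N - l)).
{ apply Rmult_le_compat_r; [apply Cmod_ge_0 | simpl; nra]. }
lra.
Qed.

(** Quantitative injectivity: the difference quotient 1 - (a^2 + ab + b^2)/3 has modulus at least 1
    - (1 + |b| + |b|^2)/3. Bounding |a| by 1 leaves a constant depending on [b] alone, so the
    inverse is Lipschitz at each point. *)
Lemma nephroid_expansion (a b : C) : Cmod a < 1 -> Cmod b < 1 ->
  (1 - Cmod b) * (2 + Cmod b) / 3 * Cmod (a - b) <=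
  Cmod ((a - a ^ 3 / 3) - (b - b ^ 3 / 3)).
Proof.
intros Ha Hb.
pose proof (Cmod_ge_0 a); pose proof (Cmod_ge_0 b).
assert (N3 : RtoC 3 <> 0%C) by (apply RtoC_neq_0; lra).
replace ((a - a ^ 3 / 3) - (b - b ^ 3 / 3))%C
  with ((1 - (a * a + (a * b + b * b)) / 3) * (a - b))%C by (field; exact N3).
rewrite Cmod_mult; apply Rmult_le_compat_r; [apply Cmod_ge_0|].
eapply Rle_trans; [|apply Cmod_minus_ge].
rewrite Cmod_1, Cmod_div, Cmod_R, (Rabs_pos_eq 3) by (try exact N3; lra).
assert (T : Cmod (a * a + (a * b + b * b)) <= 1 + (Cmod b + Cmod b * Cmod b)).
{ eapply Rle_trans; [apply Cmod_triangle|].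
  apply Rplus_le_compat; [|eapply Rle_trans; [apply Cmod_triangle|]; apply Rplus_le_compat];
    rewrite Cmod_mult; nra. }
lra.
Qed.

(** The preimage is picked by [epsilon]; injectivity pins it down at 0, and the Lipschitz bound
    makes the pick differentiable with derivative 1/(1 - w0^2). *)
Lemma nephroid_inverse : exists g : C -> C, g 0%C = 0%C /\
  forall zeta, Cmod zeta < 2 / 3 ->
    Cmod (g zeta) < 1 /\ (g zeta - g zeta ^ 3 / 3)%C = zeta /\ ex_Cderive g zeta.
Proof.
set (R0 := fun zeta omega : C => Cmod omega < 1 /\ (omega - omega ^ 3 / 3)%C = zeta).
assert (inh : inhabited C) by exact (inhabits (RtoC 0)).
set (g := fun zeta => epsilon inh (R0 zeta)).
assert (Hg : forall zeta, Cmod zeta < 2 / 3 -> R0 zeta (g zeta))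
  by (intros zeta Hz; apply epsilon_spec, nephroid_preimage, Hz).
exists g; split.
- destruct (Hg 0%C) as [H1 H2]; [rewrite Cmod_0; lra|].
  assert (T := nephroid_expansion (g 0%C) 0%C H1 ltac:(rewrite Cmod_0; lra)).
  rewrite H2, Cmod_0 in T.
  replace (0 - (0 - 0 ^ 3 / 3))%C with (RtoC 0) in T
    by (field; apply RtoC_neq_0; lra).
  rewrite Cmod_0 in T; replace (g 0 - 0)%C with (g 0%C) in T by ring.
  apply Cmod_eq_0; pose proof (Cmod_ge_0 (g 0%C)); lra.
- intros z0 Hz0; destruct (Hg z0 Hz0) as [B0 E0].
  split; [exact B0|]; split; [exact E0|].
  set (w0 := g z0) in *; set (s := Cmod w0) in *.
  assert (Ps : 0 <= s) by apply Cmod_ge_0.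
  set (k := (1 - s) * (2 + s) / 3).
  assert (Pk : 0 < k).
  { unfold k; assert (0 < (1 - s) * (2 + s)) by (apply Rmult_lt_0_compat; lra); lra. }
  assert (Ps2 : 0 < 1 - s * s) by nra.
  assert (Bd : 1 - s * s <= Cmod (1 - w0 * w0)).
  { pose proof (Cmod_minus_ge 1 (w0 * w0)) as T; rewrite Cmod_1, Cmod_mult in T; exact T. }
  assert (Nd : (1 - w0 * w0)%C <> 0%C) by (apply Cmod_gt_0; lra).
  assert (N3 : RtoC 3 <> 0%C) by (apply RtoC_neq_0; lra).
  exists (/ (1 - w0 * w0))%C; apply is_Cderive_eps; intros eps He.
  (* The linearisation error is (w - w0)^2 (w + 2 w0) / (3 (1 - w0^2)). Since |w + 2 w0| <= 3 and k
     |w - w0| <= |z - z0|, it is at most |z - z0|^2 / (k^2 (1 - s^2)). *)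
  set (d := eps * (k * k * (1 - s * s))).
  assert (Pkk : 0 < k * k * (1 - s * s))
    by (apply Rmult_lt_0_compat; [apply Rmult_lt_0_compat|]; assumption).
  assert (Hd : 0 < d) by (apply Rmult_lt_0_compat; assumption).
  exists (Rmin d (2 / 3 - Cmod z0)); split; [apply Rmin_glb_lt; lra|].
  intros z Hz; fold w0.
  assert (Z1 := Rlt_le_trans _ _ _ Hz (Rmin_l _ _)).
  assert (Z2 := Rlt_le_trans _ _ _ Hz (Rmin_r _ _)).
  destruct (Hg z) as [B E].
  { pose proof (Cmod_minus_ge z z0); lra. }
  set (w := g z) in *.
  assert (L := nephroid_expansion w w0 B B0); fold s k in L; rewrite E, E0 in L.
  replace (w - w0 - (z - z0) * / (1 - w0 * w0))%C
    with ((w - w0) * ((w - w0) * ((w + 2 * w0) / 3)) / (1 - w0 * w0))%C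
    by (rewrite <- E, <- E0; field; auto).
  rewrite Cmod_div, !Cmod_mult, Cmod_div, Cmod_R, (Rabs_pos_eq 3) by (try assumption; lra).
  set (x := Cmod (w - w0)) in *; set (y := Cmod (z - z0)) in *.
  assert (Px : 0 <= x) by apply Cmod_ge_0; assert (Py : 0 <= y) by apply Cmod_ge_0.
  assert (T : Cmod (w + 2 * w0) <= 3).
  { eapply Rle_trans; [apply Cmod_triangle|].
    rewrite Cmod_mult, Cmod_R, Rabs_pos_eq by lra; fold s; lra. }
  apply Rle_trans with (x * x / (1 - s * s)).
  { apply Rmult_le_compat.
    - repeat apply Rmult_le_pos; try assumption; try apply Cmod_ge_0; lra.
    - apply Rlt_le, Rinv_0_lt_compat; lra.
    - assert (x * (x * (Cmod (w + 2 * w0) / 3)) <= x * (x * 1))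
        by (repeat apply Rmult_le_compat_l; lra); lra.
    - apply Rinv_le_contravar; lra. }
  apply Rmult_le_reg_r with (k * k * (1 - s * s)); [exact Pkk|].
  replace (x * x / (1 - s * s) * (k * k * (1 - s * s))) with ((k * x) * (k * x)) by (field; lra).
  apply Rle_trans with (y * y).
  + apply Rmult_le_compat; try assumption; apply Rmult_le_pos; lra.
  + replace (eps * y * (k * k * (1 - s * s))) with (d * y) by (unfold d; ring).
    apply Rmult_le_compat_r; lra.
Qed.

Lemma phi_Ne_Cderive (z : C) : ex_Cderive phi_Ne z.
Proof.
destruct (is_Cderive_pow (fun y => y) z 1%C 3 (is_Cderive_id z)) as [l Hl].
eexists; unfold phi_Ne; apply is_Cderive_minus.
- apply (is_Cderive_plus (fun _ => RtoC 1) (fun y => y));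
    [apply is_Cderive_const | apply is_Cderive_id].
- apply (is_Cderive_div (fun y => y ^ 3)%C (fun _ => RtoC 3));
    [apply RtoC_neq_0; lra | exact Hl | apply is_Cderive_const].
Qed.

(** The Schwarz function is the inverse of omega - omega^3/3 applied to p - 1. *)
Lemma subordinate_phi_Ne (p : C -> C) : analytic p -> p 0%C = 1%C ->
  (forall z, in_disk z -> Cmod (p z - 1) < 2 / 3) -> subordinate p phi_Ne.
Proof.
intros Hp p0 Hb; split; [exact Hp|]; split; [intros z _; apply phi_Ne_Cderive|].
destruct nephroid_inverse as [g [g0 Hg]].
exists (fun z => g (p z - 1)%C); repeat split.
- intros z Hz; destruct (Hp z Hz) as [l Hl].
  destruct (Hg (p z - 1)%C (Hb z Hz)) as (_ & _ & [l' Hl']).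
  eexists; apply (is_Cderive_comp g (fun z => p z - 1)%C); [exact Hl'|].
  apply is_Cderive_minus; [exact Hl | apply is_Cderive_const].
- rewrite p0; replace (1 - 1)%C with (RtoC 0) by ring; exact g0.
- intros z Hz; apply Hg, Hb, Hz.
- intros z Hz; destruct (Hg (p z - 1)%C (Hb z Hz)) as (_ & E & _).
  unfold phi_Ne; replace (1 + g (p z - 1) - g (p z - 1) ^ 3 / 3)%C
    with (1 + (g (p z - 1) - g (p z - 1) ^ 3 / 3))%C by ring.
  rewrite E; ring.
Qed.

(** * Growth along rays *)

(** A mean value inequality for complex values: a factor [c] turns the increment into its modulus,
    and the real theorem applies to Re (c f) - g. Its intermediate point is interior, so the
    derivative bound is asked only for t > 0, where the subordination can be divided by t. *)
Lemma ray_increment_le (f f' : C -> C) (zeta : C) (g g' : R -> R) (r : R) : 0 <= r ->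
  (forall t : R, 0 <= t <= r -> is_Cderive f (t * zeta)%C (f' (t * zeta)%C)) ->
  (forall t, is_derive g t (g' t)) ->
  (forall t : R, 0 < t <= r -> Cmod (f' (t * zeta) * zeta)%C <= g' t) ->
  Cmod (f (r * zeta) - f 0)%C <= g r - g 0.
Proof.
intros [Hr | <-] Hf Hg Hb.
2: { replace (0 * zeta)%C with (RtoC 0) by ring; unfold Cminus.
  rewrite Cplus_opp_r, Cmod_0; lra. }
set (D := (f (r * zeta) - f 0)%C).
assert (exists c, Cmod c <= 1 /\ Re (c * D)%C = Cmod D) as [c [Hc Ec]].
{ destruct (Ceq_dec D 0%C) as [-> | N].
  - exists 0%C; rewrite Cmod_0; split; [lra | simpl; ring].
  - assert (PD : 0 < Cmod D) by (apply Cmod_gt_0, N).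
    exists (Cconj D / Cmod D)%C; split.
    + rewrite Cmod_div, Cmod_conj, Cmod_R, Rabs_pos_eq by (try apply RtoC_neq_0; lra).
      apply Req_le; field; lra.
    + replace (Cconj D / Cmod D * D)%C with ((D * Cconj D) / Cmod D)%C
        by (field; apply RtoC_neq_0; lra).
      rewrite <- Cmod2_conj, RtoC_pow.
      replace (RtoC (Cmod D) ^ 2 / Cmod D)%C with (RtoC (Cmod D))
        by (field; apply RtoC_neq_0; lra).
      reflexivity. }
assert (Hd : forall t, 0 <= t <= r -> derivable_pt_lim
  (fun t : R => Re (c * f (t * zeta))%C - g t) t (Re (c * (f' (t * zeta) * zeta))%C - g' t)).
{ intros t Ht; apply is_derive_Reals.
  apply (is_derive_minus (K := R_AbsRing) (V := R_NormedModule)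
    (fun t : R => Re (c * f (t * zeta))%C) g); [|apply Hg].
  assert (T := is_Cderive_mult (fun _ => c) f (t * zeta)%C _ _
    (is_Cderive_const c _) (Hf t Ht)).
  apply is_derive_ray in T; destruct T as [T _].
  replace (c * (f' (t * zeta) * zeta))%C
    with ((0 * f (t * zeta) + c * f' (t * zeta)) * zeta)%C by ring.
  exact T. }
destruct (MVT_cor2 _ _ 0 r Hr Hd) as [t [E Ht]].
replace (0 * zeta)%C with (RtoC 0) in E by ring.
assert (Ed : Re (c * D)%C = Re (c * f (r * zeta))%C - Re (c * f 0)%C).
{ unfold D; destruct c, (f (r * zeta)%C), (f 0%C); simpl; ring. }
assert (B : Re (c * (f' (t * zeta) * zeta))%C <= g' t).
{ eapply Rle_trans; [apply Rle_abs|]; eapply Rle_trans; [apply re_le_Cmod|].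
  rewrite Cmod_mult; specialize (Hb t ltac:(lra)).
  pose proof (Cmod_ge_0 (f' (t * zeta) * zeta)%C).
  apply Rle_trans with (1 * Cmod (f' (t * zeta) * zeta)%C); [|lra].
  apply Rmult_le_compat_r; lra. }
rewrite <- Ec, Ed.
assert ((Re (c * (f' (t * zeta) * zeta))%C - g' t) * (r - 0) <= 0).
{ assert (0 <= (g' t - Re (c * (f' (t * zeta) * zeta))%C) * (r - 0))
    by (apply Rmult_le_pos; lra). lra. }
lra.
Qed.

(* Gronwall: [|p|^2 exp (- 2 g)] is nonincreasing along the ray. *)
Lemma ray_gronwall (p p' : C -> C) (zeta : C) (g g' : R -> R) (r : R) : 0 <= r ->
  (forall t : R, 0 <= t <= r -> is_Cderive p (t * zeta)%C (p' (t * zeta)%C)) ->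
  (forall t, is_derive g t (g' t)) ->
  (forall t : R, 0 < t <= r -> Cmod (p' (t * zeta) * zeta)%C <= g' t * Cmod (p (t * zeta)%C)) ->
  g 0 = 0 -> p 0%C = 1%C -> Cmod (p (r * zeta)%C) <= exp (g r).
Proof.
intros [Hr | <-] Hp Hg Hb g0 p0.
2: { replace (0 * zeta)%C with (RtoC 0) by ring.
  rewrite p0, g0, Cmod_1, exp_0; lra. }
set (u := fun t : R => Re (p (t * zeta)%C)); set (v := fun t : R => Im (p (t * zeta)%C)).
set (u' := fun t : R => Re (p' (t * zeta) * zeta)%C).
set (v' := fun t : R => Im (p' (t * zeta) * zeta)%C).
assert (N2 : forall t : R, Cmod (p (t * zeta)%C) ^ 2 = u t * u t + v t * v t).
{ intros t; rewrite Cmod2_alt; unfold u, v; ring. }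
assert (Hd : forall t, 0 <= t <= r -> derivable_pt_lim
  (fun t => (u t * u t + v t * v t) * exp (- 2 * g t)) t
  (2 * (u t * u' t + v t * v' t - g' t * (u t * u t + v t * v t)) * exp (- 2 * g t))).
{ intros t Ht; destruct (is_derive_ray p zeta _ t (Hp t Ht)) as [Du Dv].
  apply is_derive_Reals.
  change (is_derive u t (u' t)) in Du; change (is_derive v t (v' t)) in Dv.
  specialize (Hg t).
  auto_derive.
  - repeat split; eexists; eassumption.
  - apply is_derive_unique in Du; apply is_derive_unique in Dv; apply is_derive_unique in Hg.
    change (Derive (fun x => u x) t) with (Derive u t).
    change (Derive (fun x => v x) t) with (Derive v t).
    change (Derive (fun x => g x) t) with (Derive g t).
    rewrite Du, Dv, Hg; ring. }
destruct (MVT_cor2 _ _ 0 r Hr Hd) as [t [E Ht]]; cbv beta in E.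
(* The left side, half the derivative of |p|^2, is Re (conj p p' zeta). *)
assert (u t * u' t + v t * v' t <= g' t * (u t * u t + v t * v t)).
{ rewrite <- N2.
  replace (u t * u' t + v t * v' t)
    with (Re (Cconj (p (t * zeta)%C) * (p' (t * zeta) * zeta))%C)
    by (unfold u, v, u', v'; destruct (p (t * zeta)%C), (p' (t * zeta) * zeta)%C;
        simpl; ring).
  eapply Rle_trans; [apply Rle_abs|]; eapply Rle_trans; [apply re_le_Cmod|].
  rewrite Cmod_mult, Cmod_conj; specialize (Hb t ltac:(lra)).
  pose proof (Cmod_ge_0 (p (t * zeta)%C)).
  replace (g' t * Cmod (p (t * zeta)%C) ^ 2)
    with (Cmod (p (t * zeta)%C) * (g' t * Cmod (p (t * zeta)%C))) by ring.
  apply Rmult_le_compat_l; assumption. }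
assert (M : (u r * u r + v r * v r) * exp (- 2 * g r) <= 1).
{ assert (u0 : u 0 = 1) by (unfold u; replace (0 * zeta)%C with (RtoC 0) by ring;
    rewrite p0; reflexivity).
  assert (v0 : v 0 = 0) by (unfold v; replace (0 * zeta)%C with (RtoC 0) by ring;
    rewrite p0; reflexivity).
  rewrite u0, v0, g0 in E; replace (- 2 * 0) with 0 in E by ring; rewrite exp_0 in E.
  pose proof (exp_pos (- 2 * g t)).
  assert (0 <= 2 * (g' t * (u t * u t + v t * v t) - (u t * u' t + v t * v' t))
    * exp (- 2 * g t) * (r - 0)) by (repeat apply Rmult_le_pos; lra).
  lra. }
rewrite <- N2 in M.
pose proof (exp_pos (g r)) as Pe.
apply Rnot_lt_le; intros N.
assert (exp (- 2 * g r) * (exp (g r) * exp (g r)) = 1).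
{ rewrite <- !exp_plus; replace (- 2 * g r + (g r + g r)) with 0 by ring; apply exp_0. }
assert (exp (g r) * exp (g r) < Cmod (p (r * zeta)%C) ^ 2) by (simpl; nra).
pose proof (exp_pos (- 2 * g r)); nra.
Qed.

Lemma in_disk_ray (z : C) (t : R) : in_disk z -> 0 <= t <= 1 -> in_disk (t * z)%C.
Proof.
unfold in_disk; intros Hz Ht; rewrite Cmod_mult, Cmod_R, Rabs_pos_eq by lra.
pose proof (Cmod_ge_0 z); apply Rle_lt_trans with (1 * Cmod z); [|lra].
apply Rmult_le_compat_r; lra.
Qed.

(** A continuation argument: the estimate holds as long as no zero has been met, and it keeps |p|
    above 1/3, so the supremum of the zero-free parameters can be passed until it exceeds 1. *)
Lemma ray_nonvanishing (p : C -> C) (z : C) : analytic p -> in_disk z -> p 0%C = 1%C ->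
  (forall r : R, 0 <= r <= 1 -> (forall t : R, 0 <= t <= r -> p (t * z)%C <> 0%C) ->
     Cmod (p (r * z) - 1)%C < 2 / 3) ->
  Cmod (p z - 1)%C < 2 / 3.
Proof.
intros Hp Hz p0 Hb.
assert (Hcont : forall t : R, 0 <= t <= 1 -> forall eps, 0 < eps -> exists d, 0 < d /\
  forall s : R, Rabs (s - t) < d -> Cmod (p (s * z) - p (t * z))%C < eps).
{ intros t Ht eps He.
  destruct (Hp (t * z)%C) as [l Hl]; [apply in_disk_ray; assumption|].
  destruct (is_Cderive_continuous p _ _ Hl eps He) as [d [Hd K]].
  exists d; split; [exact Hd|]; intros s Hs; apply K.
  replace (s * z - t * z)%C with (RtoC (s - t) * z)%C by (rewrite RtoC_minus; ring).
  rewrite Cmod_mult, Cmod_R.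
  apply Rle_lt_trans with (Rabs (s - t) * 1); [|lra].
  apply Rmult_le_compat_l; [apply Rabs_pos | apply Rlt_le, Hz]. }
set (good := fun r => 0 <= r <= 1 /\ forall t : R, 0 <= t <= r -> p (t * z)%C <> 0%C).
assert (G0 : good 0).
{ split; [lra|]; intros t Ht; replace t with 0 by lra.
  replace (0 * z)%C with (RtoC 0) by ring; rewrite p0; apply RtoC_neq_0; lra. }
destruct (completeness good) as [r0 [L1 L2]];
  [exists 1; intros r [Hr _]; lra | exists 0; exact G0|].
assert (R0 : 0 <= r0 <= 1).
{ split; [apply L1, G0 | apply L2; intros r [Hr _]; lra]. }
assert (Below : forall t : R, 0 <= t < r0 -> good t).
{ intros t Ht; split; [lra|]; intros s Hs E.
  enough (r0 <= s) by lra.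
  apply L2; intros r [_ Hr]; apply Rnot_lt_le; intros N; apply (Hr s); [lra | exact E]. }
(* The value 1/3 at a good parameter near [r0], less a continuity error of 1/20, still exceeds
   1/4. *)
assert (N0 : / 4 < Cmod (p (r0 * z)%C)).
{ destruct (Hcont r0 R0 (/ 20)) as [d [Hd K]]; [lra|].
  assert (exists s, good s /\ Rabs (s - r0) < d) as [s [Gs Hs]].
  { destruct (Req_dec r0 0) as [E | E].
    - exists 0; split; [exact G0|]; rewrite E, Rminus_diag, Rabs_R0; exact Hd.
    - exists (r0 - Rmin (d / 2) r0).
      assert (Rmin (d / 2) r0 <= r0) by apply Rmin_r.
      assert (Rmin (d / 2) r0 <= d / 2) by apply Rmin_l.
      assert (0 < Rmin (d / 2) r0) by (apply Rmin_glb_lt; lra).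
      split; [apply Below; lra | rewrite Rabs_left; lra]. }
  specialize (K s Hs).
  destruct Gs as [Gs1 Gs2]; assert (B := Hb s Gs1 Gs2).
  pose proof (Cmod_minus_ge 1 (p (r0 * z)%C)) as T1; rewrite Cmod_1 in T1.
  pose proof (Cmod_triangle (- (p (s * z) - 1))%C (p (s * z) - p (r0 * z))%C) as T2.
  replace (- (p (s * z) - 1) + (p (s * z) - p (r0 * z)))%C
    with (1 - p (r0 * z))%C in T2 by ring.
  rewrite Cmod_opp in T2; lra. }
destruct (Hcont r0 R0 (/ 4)) as [d [Hd K]]; [lra|].
assert (Near : forall s : R, Rabs (s - r0) < d -> p (s * z)%C <> 0%C).
{ intros s Hs E; specialize (K s Hs); rewrite E in K.
  replace (0 - p (r0 * z))%C with (- p (r0 * z))%C in K by ring.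
  rewrite Cmod_opp in K; lra. }
assert (Ext : forall r, 0 <= r <= 1 -> r < r0 + d -> good r).
{ intros r Hr1 Hr2; split; [exact Hr1|]; intros s Hs.
  destruct (Rlt_le_dec s r0) as [L | L].
  - apply (Below s); lra.
  - apply Near; rewrite Rabs_pos_eq; lra. }
assert (G1 : good 1).
{ destruct (Rlt_le_dec 1 (r0 + d)) as [L | L]; [apply Ext; lra|].
  assert (r0 + d / 2 <= r0) by (apply L1, Ext; lra); lra. }
destruct G1 as [H1 H2]; specialize (Hb 1 H1 H2).
replace (1 * z)%C with z in Hb by ring; exact Hb.
Qed.

(** * The radial majorant and the three sufficient bounds *)

Definition slope (beta m t : R) : R := (4 / 3 * m + 2 / 3 * m ^ 2 * t) / beta.
Definition growth (beta m t : R) : R := (4 / 3 * m * t + / 3 * m ^ 2 * t ^ 2) / beta.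

Lemma is_derive_growth (beta m t : R) : 0 < beta ->
  is_derive (growth beta m) t (slope beta m t).
Proof. intros H; unfold growth, slope; auto_derive; [trivial | field; lra]. Qed.

Lemma growth_0 (beta m : R) : growth beta m 0 = 0.
Proof. unfold growth, Rdiv; ring. Qed.

(** At m t = 1 the numerator would be 4/3 + 1/3 = 5/3. Strictness, from m < 1, is what admits [beta]
    equal to the threshold. *)
Lemma growth_lt (beta m t : R) : 0 < beta -> 0 <= m < 1 -> 0 <= t <= 1 ->
  growth beta m t < 5 / (3 * beta).
Proof.
intros Hb Hm Ht; unfold growth.
replace (5 / (3 * beta)) with (5 / 3 / beta) by (field; lra).
apply Rmult_lt_compat_r; [apply Rinv_0_lt_compat; exact Hb|].
replace (4 / 3 * m * t + / 3 * m ^ 2 * t ^ 2)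
  with (4 / 3 * (m * t) + / 3 * ((m * t) * (m * t))) by ring.
assert (0 <= m * t) by (apply Rmult_le_pos; lra).
assert (m * t < 1) by (apply Rle_lt_trans with (m * 1); [apply Rmult_le_compat_l|]; lra).
nra.
Qed.

(** Serves all three cases, with [q] equal to 1, p or p^2 at t z. The t in t z cancels one t of the
    bound |omega| <= t |z|, leaving a majorant regular at t = 0. *)
Lemma phi_C_slope (beta t : R) (z omega d q : C) : 0 < beta -> 0 < t -> q <> 0%C ->
  Cmod omega <= Cmod (t * z)%C ->
  (1 + beta * (t * z * d / q))%C = phi_C omega ->
  Cmod (d * z)%C <= slope beta (Cmod z) t * Cmod q.
Proof.
intros Hb Ht Hq Hw E.
assert (Pq : 0 < Cmod q) by (apply Cmod_gt_0, Hq).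
assert (Nt : RtoC t <> 0%C) by (apply RtoC_neq_0; lra).
assert (Nb : RtoC beta <> 0%C) by (apply RtoC_neq_0; lra).
assert (N3 : RtoC 3 <> 0%C) by (apply RtoC_neq_0; lra).
rewrite Cmod_mult, Cmod_R, Rabs_pos_eq in Hw by lra.
assert (E2 : (d * z)%C = ((4 * omega / 3 + 2 * omega ^ 2 / 3) * q / (t * beta))%C).
{ replace (4 * omega / 3 + 2 * omega ^ 2 / 3)%C with (phi_C omega - 1)%C
    by (unfold phi_C; ring).
  rewrite <- E; field; auto. }
rewrite E2, Cmod_div, !Cmod_mult, !Cmod_R, (Rabs_pos_eq t), (Rabs_pos_eq beta)
  by (try apply Cmult_neq_0; try assumption; lra).
set (m := Cmod z) in *; set (w := Cmod omega) in *.
assert (Pw : 0 <= w) by apply Cmod_ge_0.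
assert (B : Cmod (4 * omega / 3 + 2 * omega ^ 2 / 3) <= 4 / 3 * (t * m) + 2 / 3 * (t * m) ^ 2).
{ eapply Rle_trans; [apply Cmod_triangle|].
  rewrite !Cmod_div, !Cmod_mult, Cmod_pow, !Cmod_R, !Rabs_pos_eq by (try exact N3; lra).
  fold w; assert (w ^ 2 <= (t * m) ^ 2) by (apply pow_incr; lra); lra. }
apply Rle_trans with ((4 / 3 * (t * m) + 2 / 3 * (t * m) ^ 2) * Cmod q / (t * beta)).
- apply Rmult_le_compat_r.
  + apply Rlt_le, Rinv_0_lt_compat, Rmult_lt_0_compat; assumption.
  + apply Rmult_le_compat_r; lra.
- apply Req_le; unfold slope; field; lra.
Qed.

Lemma is_Cderive_C_derive (p : C -> C) (z : C) : analytic p -> in_disk z ->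
  is_Cderive p z (C_derive p z).
Proof. intros Hp Hz; apply C_derive_correct; [exact z | apply Hp, Hz]. Qed.

Lemma valid_a : valid_from implication_a (5 / 2).
Proof.
intros beta Hbeta p Hp p0 (_ & _ & w & Hw & w0 & Hdisk & E).
apply subordinate_phi_Ne; [exact Hp | exact p0|]; intros z Hz.
assert (T := ray_increment_le p (C_derive p) z (growth beta (Cmod z))
  (slope beta (Cmod z)) 1 Rle_0_1).
replace (1 * z)%C with z in T by ring; rewrite p0, growth_0 in T.
eapply Rle_lt_trans; [apply T|].
- intros t Ht; apply is_Cderive_C_derive; [exact Hp | apply in_disk_ray; assumption].
- intros t; apply is_derive_growth; lra.
- intros t Ht.
  assert (Dt : in_disk (t * z)%C) by (apply in_disk_ray; [exact Hz | lra]).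
  replace (slope beta (Cmod z) t) with (slope beta (Cmod z) t * Cmod 1%C)
    by (rewrite Cmod_1; ring).
  apply (phi_C_slope beta t z (w (t * z)%C)); try lra.
  + apply RtoC_neq_0; lra.
  + apply schwarz_lemma; assumption.
  + rewrite <- E by exact Dt; field; apply RtoC_neq_0; lra.
- pose proof (Cmod_ge_0 z).
  assert (G := growth_lt beta (Cmod z) 1 ltac:(lra) (conj H Hz) ltac:(lra)).
  assert (5 / (3 * beta) <= 2 / 3); [|lra].
  apply Rmult_le_reg_r with (3 * beta); [lra|].
  unfold Rdiv at 1; rewrite Rmult_assoc, Rinv_l by lra; lra.
Qed.

Lemma ln_5_3_pos : 0 < ln (5 / 3).
Proof. rewrite <- ln_1; apply ln_increasing; lra. Qed.

(** Gronwall turns the bound on p'/p into one on p' by the derivative of exp (growth), so |p - 1| <=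
    exp (growth) - 1 without a complex logarithm. *)
Lemma valid_b : valid_from implication_b (5 / (3 * ln (5 / 3))).
Proof.
intros beta Hbeta p Hp p0 (_ & _ & w & Hw & w0 & Hdisk & E).
pose proof ln_5_3_pos as L.
assert (Pb : 0 < beta).
{ apply Rlt_le_trans with (2 := Hbeta); apply Rdiv_lt_0_compat; lra. }
apply subordinate_phi_Ne; [exact Hp | exact p0|]; intros z Hz.
apply ray_nonvanishing; try assumption; intros r Hr NV.
pose proof (Cmod_ge_0 z) as Pm; set (m := Cmod z) in *.
assert (Dp : forall t : R, 0 <= t <= r -> is_Cderive p (t * z)%C (C_derive p (t * z)%C)).
{ intros t Ht; apply is_Cderive_C_derive; [exact Hp | apply in_disk_ray; [exact Hz | lra]]. }
assert (B : forall t : R, 0 < t <= r ->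
  Cmod (C_derive p (t * z) * z)%C <= slope beta m t * Cmod (p (t * z)%C)).
{ intros t Ht.
  assert (Dt : in_disk (t * z)%C) by (apply in_disk_ray; [exact Hz | lra]).
  apply (phi_C_slope beta t z (w (t * z)%C)); try lra.
  - apply NV; lra.
  - apply schwarz_lemma; assumption.
  - rewrite <- E by exact Dt; reflexivity. }
assert (T := ray_increment_le p (C_derive p) z (fun t => exp (growth beta m t))
  (fun t => slope beta m t * exp (growth beta m t)) r (proj1 Hr) Dp).
cbv beta in T; rewrite p0, growth_0, exp_0 in T.
eapply Rle_lt_trans; [apply T|].
- intros t; apply (is_derive_comp exp (growth beta m));
    [apply is_derive_exp | apply is_derive_growth; exact Pb].
- intros t Ht; eapply Rle_trans; [apply B; exact Ht|].
  assert (0 <= slope beta m t).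
  { unfold slope; apply Rmult_le_pos; [|apply Rlt_le, Rinv_0_lt_compat, Pb].
    assert (0 <= m ^ 2 * t) by (apply Rmult_le_pos; [apply pow2_ge_0 | lra]); lra. }
  apply Rmult_le_compat_l; [assumption|].
  apply (ray_gronwall p (C_derive p) z (growth beta m) (slope beta m) t); try lra.
  + intros s Hs; apply Dp; lra.
  + intros s; apply is_derive_growth, Pb.
  + intros s Hs; apply B; lra.
  + apply growth_0.
  + exact p0.
- assert (G := growth_lt beta m r Pb (conj Pm Hz) Hr).
  assert (G2 : 5 / (3 * beta) <= ln (5 / 3)).
  { apply Rmult_le_reg_r with (3 * beta); [lra|].
    unfold Rdiv at 1; rewrite Rmult_assoc, Rinv_l by lra.
    apply (Rmult_le_compat_r (3 * ln (5 / 3))) in Hbeta; [|lra].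
    unfold Rdiv at 1 in Hbeta; rewrite Rmult_assoc, Rinv_l in Hbeta by lra; lra. }
  assert (exp (growth beta m r) < exp (ln (5 / 3))) by (apply exp_increasing; lra).
  rewrite exp_ln in H by lra; lra.
Qed.

(** The quotient p'/p^2 is, up to sign, the derivative of 1/p, so the increment of 1/p is estimated
    directly. *)
Lemma valid_c : valid_from implication_c (25 / 6).
Proof.
intros beta Hbeta p Hp p0 (_ & _ & w & Hw & w0 & Hdisk & E).
assert (Pb : 0 < beta) by lra.
apply subordinate_phi_Ne; [exact Hp | exact p0|]; intros z Hz.
apply ray_nonvanishing; try assumption; intros r Hr NV.
pose proof (Cmod_ge_0 z) as Pm; set (m := Cmod z) in *.
assert (T := ray_increment_le (fun y => / p y)%C
  (fun y => C_derive p y * - / (p y * p y))%C z (growth beta m) (slope beta m) r (proj1 Hr)).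
cbv beta in T; rewrite p0, growth_0 in T.
assert (Np := NV r ltac:(lra)).
assert (G := growth_lt beta m r Pb (conj Pm Hz) Hr).
assert (G2 : 5 / (3 * beta) <= 2 / 5).
{ apply Rmult_le_reg_r with (3 * beta); [lra|].
  unfold Rdiv at 1; rewrite Rmult_assoc, Rinv_l by lra; lra. }
assert (B : Cmod (/ p (r * z) - / 1)%C < 2 / 5).
{ eapply Rle_lt_trans; [apply T|lra].
  - intros t Ht.
    apply (is_Cderive_comp Cinv p); [apply is_Cderive_inv, NV, Ht|].
    apply is_Cderive_C_derive; [exact Hp | apply in_disk_ray; [exact Hz | lra]].
  - intros t; apply is_derive_growth, Pb.
  - intros t Ht.
    assert (Dt : in_disk (t * z)%C) by (apply in_disk_ray; [exact Hz | lra]).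
    assert (Nt := NV t ltac:(lra)).
    assert (K : Cmod (C_derive p (t * z) * z)%C <=
      slope beta m t * Cmod (p (t * z) ^ 2)%C).
    { apply (phi_C_slope beta t z (w (t * z)%C)); try lra.
      - simpl; rewrite Cmult_1_r; apply Cmult_neq_0; exact Nt.
      - apply schwarz_lemma; assumption.
      - rewrite <- E by exact Dt; reflexivity. }
    replace (C_derive p (t * z) * - / (p (t * z) * p (t * z)) * z)%C
      with (- (C_derive p (t * z) * z / (p (t * z) ^ 2)))%C by (field; exact Nt).
    assert (Nt2 : (p (t * z) ^ 2)%C <> 0%C)
      by (simpl; rewrite Cmult_1_r; apply Cmult_neq_0; exact Nt).
    assert (P2 : 0 < Cmod (p (t * z) ^ 2)%C) by (apply Cmod_gt_0, Nt2).
    rewrite Cmod_opp, Cmod_div by exact Nt2.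
    apply Rmult_le_reg_r with (Cmod (p (t * z) ^ 2)%C); [exact P2|].
    unfold Rdiv; rewrite Rmult_assoc, Rinv_l by lra; lra. }
set (q := p (r * z)%C) in *.
assert (Pq : 0 < Cmod q) by (apply Cmod_gt_0, Np).
(* From |q - 1| < 2/5 |q| <= 2/5 (1 + |q - 1|) follows |q - 1| < 2/3. *)
assert (E1 : Cmod (q - 1) = Cmod (/ q - / 1) * Cmod q).
{ rewrite <- Cmod_mult, <- Cmod_opp; f_equal; field; exact Np. }
pose proof (Cmod_triangle (q - 1) 1) as T1.
replace (q - 1 + 1)%C with q in T1 by ring; rewrite Cmod_1 in T1.
assert (Cmod (/ q - / 1) * Cmod q < 2 / 5 * Cmod q) by (apply Rmult_lt_compat_r; assumption).
lra.
Qed.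

(** * Extremal functions *)

(** The imaginary part of 3 phi_Ne is y (3 - 3 x^2 + y^2), whose second factor is positive in the
    disk, so real values come from real points; there 5/3 - phi_Ne(x) = (1 - x)^2 (x + 2)/3. *)
Lemma phi_Ne_real_le (omega : C) (v : R) : in_disk omega -> phi_Ne omega = RtoC v ->
  v <= 5 / 3.
Proof.
unfold in_disk; intros H E.
assert (H2 : Cmod omega ^ 2 < 1).
{ pose proof (Cmod_ge_0 omega); simpl; nra. }
rewrite Cmod2_alt in H2; destruct omega as [x y]; cbn [Re Im fst snd] in H2.
assert (E1 := f_equal (fun c => 3 * fst c) E); assert (E2 := f_equal (fun c => 3 * snd c) E).
unfold phi_Ne in E1, E2; simpl in E1, E2.
field_simplify in E1; field_simplify in E2.
pose proof (pow2_ge_0 x); pose proof (pow2_ge_0 y).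
assert (Y : y * (3 - 3 * x ^ 2 + y ^ 2) = 0) by nra.
apply Rmult_integral in Y; destruct Y as [-> | Y]; [|nra].
assert (x < 1) by nra; assert (- 1 < x) by nra.
assert (0 <= (1 - x) ^ 2 * (x + 2))
  by (apply Rmult_le_pos; [apply pow2_ge_0 | lra]).
nra.
Qed.

Lemma phi_C_Cderive (z : C) : ex_Cderive phi_C z.
Proof.
assert (N3 : RtoC 3 <> 0%C) by (apply RtoC_neq_0; lra).
destruct (is_Cderive_pow (fun y => y) z 1%C 2 (is_Cderive_id z)) as [l Hl].
eexists; unfold phi_C.
apply (is_Cderive_plus (fun z => 1 + 4 * z / 3)%C (fun z => 2 * z ^ 2 / 3)%C).
- apply is_Cderive_plus; [apply is_Cderive_const|].
  apply (is_Cderive_div (fun z => 4 * z)%C (fun _ => RtoC 3)); [exact N3| |apply is_Cderive_const].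
  apply (is_Cderive_mult (fun _ => RtoC 4) (fun z => z));
    [apply is_Cderive_const | apply is_Cderive_id].
- apply (is_Cderive_div (fun z => 2 * z ^ 2)%C (fun _ => RtoC 3)); [exact N3| |apply is_Cderive_const].
  apply (is_Cderive_mult (fun _ => RtoC 2) (fun z => z ^ 2)%C);
    [apply is_Cderive_const | exact Hl].
Qed.

(** The identity is a Schwarz function for the premise, while a real value above 5/3 lies outside
    the range of phi_Ne. *)
Lemma not_sufficient_for_Ne (Psi : (C -> C) -> C -> C) (q : C -> C) (x v : R) :
  analytic q -> q 0%C = 1%C -> (forall z, in_disk z -> Psi q z = phi_C z) ->
  0 < x < 1 -> q (RtoC x) = RtoC v -> 5 / 3 < v -> ~ sufficient_for_Ne Psi.
Proof.
intros Hq q0 HP Hx Ev Hv S.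
destruct (S q Hq q0) as (_ & _ & w & _ & _ & Hdisk & E).
- split; [|split; [intros z _; apply phi_C_Cderive|]].
  + intros z Hz; destruct (phi_C_Cderive z) as [l Hl]; exists l.
    (* The two functions agree only inside the disk; a neighbourhood of radius 1 - |z| stays
       there. *)
    assert (D : 0 < 1 - Cmod z) by (unfold in_disk in Hz; lra).
    apply (is_Cderive_ext_loc phi_C _ z l _ D); [|exact Hl].
    intros y Hy; symmetry; apply HP.
    pose proof (Cmod_minus_ge y z); unfold in_disk; lra.
  + exists (fun z => z); repeat split; auto.
    intros z _; eexists; apply is_Cderive_id.
- assert (Dx : in_disk (RtoC x)) by (unfold in_disk; rewrite Cmod_R, Rabs_pos_eq; lra).
  specialize (E _ Dx); rewrite Ev in E; symmetry in E.
  apply phi_Ne_real_le in E; [lra | apply Hdisk, Dx].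
Qed.

(* The solution of [h 0 = 0], [z h' z = phi_C z - 1]. *)
Definition cardioid_primitive (z : C) : C := (4 * z / 3 + z ^ 2 / 3)%C.

Lemma is_Cderive_cardioid_primitive (z : C) :
  is_Cderive cardioid_primitive z (4 / 3 + 2 * z / 3)%C.
Proof.
assert (N3 : RtoC 3 <> 0%C) by (apply RtoC_neq_0; lra).
apply (is_Cderive_ext_loc (fun z => (4 + z) * z * / 3)%C _ z _ 1 Rlt_0_1).
{ intros y _; unfold cardioid_primitive; field; exact N3. }
replace (4 / 3 + 2 * z / 3)%C with
  (((0 + 1) * z + (4 + z) * 1) * / 3 + (4 + z) * z * 0)%C by (field; exact N3).
apply (is_Cderive_mult (fun z => (4 + z) * z)%C (fun _ => / 3)%C); [|apply is_Cderive_const].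
apply (is_Cderive_mult (fun z => 4 + z)%C (fun z => z)); [|apply is_Cderive_id].
apply (is_Cderive_plus (fun _ => RtoC 4) (fun z => z));
  [apply is_Cderive_const | apply is_Cderive_id].
Qed.

Lemma is_Cderive_cardioid_primitive_div (beta : R) (z : C) : 0 < beta ->
  is_Cderive (fun z : C => cardioid_primitive z / beta)%C z ((4 / 3 + 2 * z / 3) / beta)%C.
Proof.
intros Hb; assert (Nb : RtoC beta <> 0%C) by (apply RtoC_neq_0; lra).
replace ((4 / 3 + 2 * z / 3) / beta)%C
  with ((4 / 3 + 2 * z / 3) * / beta + cardioid_primitive z * 0)%C
  by (unfold Cdiv; ring).
apply (is_Cderive_mult cardioid_primitive (fun _ => / beta)%C);
  [apply is_Cderive_cardioid_primitive | apply is_Cderive_const].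
Qed.

Lemma cardioid_primitive_0 (beta : R) : (cardioid_primitive 0 / beta)%C = 0%C.
Proof. unfold cardioid_primitive, Cdiv; ring. Qed.

Lemma cardioid_primitive_real (beta x : R) : 0 < beta ->
  (cardioid_primitive x / beta)%C = RtoC ((4 * x / 3 + x ^ 2 / 3) / beta).
Proof.
intros Hb; unfold cardioid_primitive.
rewrite RtoC_div by lra.
rewrite RtoC_plus, !RtoC_div, RtoC_mult, RtoC_pow by lra; reflexivity.
Qed.

(** The value 5/(3 beta) belongs to the boundary point 1. At x = 1 - e the numerator is 5/3 - 2 e +
    e^2/3, and e is at most a quarter of the gap 5/3 - c beta. *)
Lemma cardioid_primitive_near_1 (beta c : R) : 0 < beta -> c < 5 / (3 * beta) ->
  exists x, 0 < x < 1 /\ c < (4 * x / 3 + x ^ 2 / 3) / beta.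
Proof.
intros Hb Hc.
assert (K : c * beta < 5 / 3).
{ apply (Rmult_lt_compat_r beta) in Hc; [|exact Hb].
  replace (5 / (3 * beta) * beta) with (5 / 3) in Hc by (field; lra); exact Hc. }
set (e := Rmin (/ 2) ((5 / 3 - c * beta) / 4)).
assert (E1 : e <= / 2) by apply Rmin_l.
assert (E2 : e <= (5 / 3 - c * beta) / 4) by apply Rmin_r.
assert (E3 : 0 < e) by (apply Rmin_glb_lt; lra).
exists (1 - e); split; [lra|].
apply Rmult_lt_reg_r with beta; [exact Hb|].
unfold Rdiv at 1; rewrite Rmult_assoc, Rinv_l by lra.
pose proof (pow2_ge_0 e); simpl in *; lra.
Qed.

Lemma Cmod_cardioid_primitive (z : C) : in_disk z -> Cmod (cardioid_primitive z) < 5 / 3.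
Proof.
unfold in_disk, cardioid_primitive; intros Hz.
assert (N3 : RtoC 3 <> 0%C) by (apply RtoC_neq_0; lra).
pose proof (Cmod_ge_0 z).
eapply Rle_lt_trans; [apply Cmod_triangle|].
rewrite !Cmod_div, Cmod_mult, Cmod_pow, !Cmod_R, !Rabs_pos_eq by (try exact N3; lra).
simpl; nra.
Qed.

(** * Sharpness of the three thresholds *)

Lemma sharp_a : sharp implication_a (5 / 2).
Proof.
(* As [b] may be negative or zero, a positive [beta] is taken between [b] and the threshold. *)
intros b Hb V; set (beta := Rmax b 1).
assert (B1 : b <= beta) by apply Rmax_l; assert (B2 : 1 <= beta) by apply Rmax_r.
assert (B3 : beta < 5 / 2) by (apply Rmax_lub_lt; lra).
assert (Pb : 0 < beta) by lra.
assert (Nb : RtoC beta <> 0%C) by (apply RtoC_neq_0; lra).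
destruct (cardioid_primitive_near_1 beta (2 / 3) Pb) as [x [Hx Hv]].
{ apply Rmult_lt_reg_r with (3 * beta); [lra|].
  unfold Rdiv at 2; rewrite Rmult_assoc, Rinv_l by lra; lra. }
assert (Dq : forall z, is_Cderive (fun z : C => 1 + cardioid_primitive z / beta)%C z
  (0 + (4 / 3 + 2 * z / 3) / beta)%C).
{ intros z; apply (is_Cderive_plus (fun _ => RtoC 1));
    [apply is_Cderive_const | apply is_Cderive_cardioid_primitive_div, Pb]. }
apply (not_sufficient_for_Ne _ (fun z => 1 + cardioid_primitive z / beta)%C x
  (1 + (4 * x / 3 + x ^ 2 / 3) / beta)) with (7 := V beta B1); try lra.
- intros z _; eexists; apply Dq.
- rewrite cardioid_primitive_0; ring.
- intros z _; cbv beta; rewrite (is_C_derive_unique _ _ _ (Dq z)); unfold phi_C.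
  field; auto.
- rewrite cardioid_primitive_real, RtoC_plus by exact Pb; reflexivity.
Qed.

Lemma sharp_b : sharp implication_b (5 / (3 * ln (5 / 3))).
Proof.
intros b Hb V; set (beta := Rmax b 1).
assert (B1 : b <= beta) by apply Rmax_l; assert (B2 : 1 <= beta) by apply Rmax_r.
pose proof ln_5_3_pos as L.
(* This says that 1, the lower bound imposed on [beta], lies below the threshold. *)
assert (L2 : ln (5 / 3) < 5 / 3).
{ rewrite <- (ln_exp (5 / 3)) at 2; apply ln_increasing; [lra|].
  pose proof (exp_ineq1 (5 / 3)); lra. }
assert (B3 : beta < 5 / (3 * ln (5 / 3))).
{ apply Rmax_lub_lt; [exact Hb|].
  apply Rmult_lt_reg_r with (3 * ln (5 / 3)); [lra|].
  unfold Rdiv at 2; rewrite Rmult_assoc, Rinv_l by lra; lra. }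
assert (Pb : 0 < beta) by lra.
assert (Nb : RtoC beta <> 0%C) by (apply RtoC_neq_0; lra).
destruct (cardioid_primitive_near_1 beta (ln (5 / 3)) Pb) as [x [Hx Hv]].
{ apply Rmult_lt_reg_r with (3 * beta); [lra|].
  unfold Rdiv at 2; rewrite Rmult_assoc, Rinv_l by lra.
  apply (Rmult_lt_compat_r (3 * ln (5 / 3))) in B3; [|lra].
  unfold Rdiv at 2 in B3; rewrite Rmult_assoc, Rinv_l in B3 by lra; lra. }
assert (Dq : forall z, is_Cderive (fun z : C => Cexp (cardioid_primitive z / beta))%C z
  ((4 / 3 + 2 * z / 3) / beta * Cexp (cardioid_primitive z / beta))%C).
{ intros z; apply (is_Cderive_comp Cexp);
    [apply is_Cderive_exp | apply is_Cderive_cardioid_primitive_div, Pb]. }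
assert (ER : forall r : R, Cexp r = RtoC (exp r)).
{ intros r; unfold Cexp; simpl; rewrite cos_0, sin_0, Rmult_1_r, Rmult_0_r; reflexivity. }
apply (not_sufficient_for_Ne _ (fun z => Cexp (cardioid_primitive z / beta))%C x
  (exp ((4 * x / 3 + x ^ 2 / 3) / beta))) with (7 := V beta B1); try lra.
- intros z _; eexists; apply Dq.
- rewrite cardioid_primitive_0, ER, exp_0; reflexivity.
- intros z _; cbv beta; rewrite (is_C_derive_unique _ _ _ (Dq z)); unfold phi_C.
  pose proof (Cexp_neq_0 (cardioid_primitive z / beta)%C).
  field; auto.
- rewrite cardioid_primitive_real by exact Pb; apply ER.
- rewrite <- (exp_ln (5 / 3)) by lra; apply exp_increasing, Hv.
Qed.

Lemma sharp_c : sharp implication_c (25 / 6).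
Proof.
(* The 2 exceeds 5/3, the bound for [cardioid_primitive] in the disk, so the extremal function 1/(1
   - h/beta) has no pole there. *)
intros b Hb V; set (beta := Rmax b 2).
assert (B1 : b <= beta) by apply Rmax_l; assert (B2 : 2 <= beta) by apply Rmax_r.
assert (B3 : beta < 25 / 6) by (apply Rmax_lub_lt; lra).
assert (Pb : 0 < beta) by lra.
assert (Nb : RtoC beta <> 0%C) by (apply RtoC_neq_0; lra).
destruct (cardioid_primitive_near_1 beta (2 / 5) Pb) as [x [Hx Hv]].
{ apply Rmult_lt_reg_r with (3 * beta); [lra|].
  unfold Rdiv at 2; rewrite Rmult_assoc, Rinv_l by lra; lra. }
assert (Small : forall z, in_disk z -> Cmod (cardioid_primitive z / beta)%C < 1).
{ intros z Hz; apply Cmod_cardioid_primitive in Hz.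
  rewrite Cmod_div, Cmod_R, Rabs_pos_eq by (try exact Nb; lra).
  apply Rmult_lt_reg_r with beta; [lra|].
  unfold Rdiv; rewrite Rmult_assoc, Rinv_l by lra; lra. }
assert (Nq : forall z, in_disk z -> (1 - cardioid_primitive z / beta)%C <> 0%C).
{ intros z Hz; apply Cmod_gt_0.
  pose proof (Cmod_minus_ge 1 (cardioid_primitive z / beta)) as T.
  rewrite Cmod_1 in T; specialize (Small z Hz); lra. }
assert (Dq : forall z, in_disk z ->
  is_Cderive (fun z : C => / (1 - cardioid_primitive z / beta))%C z
  ((0 - (4 / 3 + 2 * z / 3) / beta) *
   - / ((1 - cardioid_primitive z / beta) * (1 - cardioid_primitive z / beta)))%C).
{ intros z Hz; apply (is_Cderive_comp Cinv (fun z => 1 - cardioid_primitive z / beta)%C).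
  - apply is_Cderive_inv, Nq, Hz.
  - apply (is_Cderive_minus (fun _ => RtoC 1));
      [apply is_Cderive_const | apply is_Cderive_cardioid_primitive_div, Pb]. }
set (v := (4 * x / 3 + x ^ 2 / 3) / beta) in *.
assert (Hv1 : v < 1).
{ assert (Dx : in_disk (RtoC x)) by (unfold in_disk; rewrite Cmod_R, Rabs_pos_eq; lra).
  apply Small in Dx; rewrite cardioid_primitive_real, Cmod_R in Dx by exact Pb.
  eapply Rle_lt_trans; [apply Rle_abs | exact Dx]. }
apply (not_sufficient_for_Ne _ (fun z => / (1 - cardioid_primitive z / beta))%C x
  (/ (1 - v))) with (7 := V beta B1); try lra.
- intros z Hz; eexists; apply Dq, Hz.
- rewrite cardioid_primitive_0; field.
- intros z Hz; cbv beta; rewrite (is_C_derive_unique _ _ _ (Dq z Hz)); unfold phi_C.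
  specialize (Nq z Hz); set (u := (1 - cardioid_primitive z / beta)%C) in *.
  field; auto.
- rewrite cardioid_primitive_real, RtoC_inv, RtoC_minus by (try exact Pb; lra); reflexivity.
(* As v > 2/5, the value 1/(1 - v) exceeds 5/3. *)
- apply Rmult_lt_reg_r with (1 - v); [lra|].
  rewrite Rinv_l by lra; lra.
Qed.

Theorem theorem3p2 :
  (valid_from implication_a (5 / 2)%R /\
   valid_from implication_b (5 / (3 * ln (5 / 3)))%R /\
   valid_from implication_c (25 / 6)%R) /\
  (sharp implication_a (5 / 2)%R /\
   sharp implication_b (5 / (3 * ln (5 / 3)))%R /\
   sharp implication_c (25 / 6)%R).
Proof.
exact (conj (conj valid_a (conj valid_b valid_c)) (conj sharp_a (conj sharp_b sharp_c))).
Qed.
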